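(* There exists a constant $\alpha$ (effectively computable) such that for every $\epsilon>0$ and all sufficiently large $n$, \[Q(n) = \alpha^{n\left(1+O\left(\exp\left(-\sqrt{\left(\frac{1}{6}-\epsilon\right)\log n \log \log n}\right)\right)\right)},\] equivalently \[\log Q(n) = n\log \alpha + O\left(n\exp\left(-\sqrt{\left(\tfrac{1}{6}-\epsilon\right)\log n \log \log n}\right)\right).\]
   Context: A set of positive integers is primitive if no element of the set divides another element of the set. $Q(n)$ denotes the number of primitive subsets of $\{1,2,\ldots,n\}$ (including the empty set). *)

(* Defs.v *)
From HB Require Import structures.
From mathcomp Require Import all_boot all_order all_algebra.
From mathcomp Require Import all_classical all_reals all_analysis.

Set Implicit Arguments.
Unset Strict Implicit.
Unset Printing Implicit Defensive.

Import Order.TTheory GRing.Theory Num.Theory.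
Import numFieldNormedType.Exports.

Local Open Scope ring_scope.

Definition primitive (N : nat) (A : {set 'I_N}) : bool :=
  [forall a in A, (0 < a)%N] &&
  [forall a in A, forall b in A, (a != b) ==> ~~ (a %| b)%N].

(* The type 'I_n.+1 is {0, ..., n}; primitivity excludes 0, so this counts
   subsets of {1, ..., n}. *)
Definition Q (n : nat) : nat := #|[set A : {set 'I_n.+1} | primitive A]|.

(* The total (general) recursive functions nat^n -> nat.  The minimization
   clause applies only to regular functions: h is the least zero of f in its
   first argument, and such a zero is required to exist everywhere. *)
Inductive recursive : forall n : nat, (n.-tuple nat -> nat) -> Prop :=
| recursive_zero n : @recursive n (fun _ => 0%N)
| recursive_succ : @recursive 1 (fun x => (tnth x ord0).+1)
| recursive_proj n (i : 'I_n) : @recursive n (fun x => tnth x i)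
| recursive_comp m n (f : m.-tuple nat -> nat)
    (g : 'I_m -> n.-tuple nat -> nat) :
    recursive f -> (forall i, recursive (g i)) ->
    @recursive n (fun x => f [tuple g i x | i < m])
| recursive_primrec n (f : n.-tuple nat -> nat) (g : n.+2.-tuple nat -> nat)
    (h : n.+1.-tuple nat -> nat) :
    recursive f -> recursive g ->
    (forall x : n.-tuple nat, h [tuple of 0%N :: x] = f x) ->
    (forall (k : nat) (x : n.-tuple nat),
       h [tuple of k.+1 :: x] =
       g [tuple of k :: h [tuple of k :: x] :: x]) ->
    recursive h
| recursive_min n (f : n.+1.-tuple nat -> nat) (h : n.-tuple nat -> nat) :
    recursive f ->
    (forall x : n.-tuple nat, f [tuple of h x :: x] = 0%N) ->
    (forall (x : n.-tuple nat) (k : nat),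
       (k < h x)%N -> f [tuple of k :: x] <> 0%N) ->
    recursive h.

Definition recursive1 (f : nat -> nat) : Prop :=
  @recursive 1 (fun x => f (tnth x ord0)).

(* Computable reals: there is a recursive sequence of rationals
   (-1)^s(k) a(k) / b(k) converging to x with error at most 2^-k. *)
Definition computable_real (R : realType) (x : R) : Prop :=
  exists s a b : nat -> nat,
    [/\ recursive1 s, recursive1 a, recursive1 b,
        forall k, b k <> 0%N &
        forall k, `|x - (-1) ^+ s k * (a k)%:R / (b k)%:R| <= 2 ^- k].

(* For c < 0 the square root is 0 once log (log n) >= 0, by the convention on
   Num.sqrt. *)
Definition error_term (R : realType) (c : R) (n : nat) : R :=
  expR (- Num.sqrt (c * ln n%:R * ln (ln n%:R))).

(* Main.v *)
(* Fix [t] and call a set [t]-primitive when no two of its elements differ by a factor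
   having only primes at most [t].  The logarithms of the numbers of primitive and of
   [t]-primitive subsets of [1..n] differ by at most [n ln 2 / t], because in [(n/t, n]]
   all quotients are smaller than [t].  The [t]-primitive sets split along the [t]-rough
   parts of the integers, so the logarithm of their number is
     [sum_(k <= n) d (t-smooth part of k) = sum_(j t-smooth) d j * Phi (n / j)]
   with [0 <= d <= ln 2] and [Phi] counting [t]-rough numbers.  Sieving by the primes up
   to [t] and Rankin's trick (the rounding error [min (1/n, 1/j)] is at most
   [n^(-eta) j^(eta - 1)]) compare this sum, divided by [n], for two values of [n] up to
     [n^(-eta) prod_(p <= t) (1 + p^(eta-1)) / (1 - p^(eta-1))].
   With [s = sqrt (ln n ln ln n / 6)], [t] about [exp s], [t^eta = (ln n)^(1/4)] and
   Chebyshev's bound for the sum of [1/p], this is at most [exp (-s)].  Hence [ln Q n / n]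
   converges at this explicit rate, which also makes the limit computable, [Q] being
   recursive. *)

Require Import Defs.
From HB Require Import structures.
From mathcomp Require Import all_boot all_order all_algebra.
From mathcomp Require Import all_classical all_reals all_analysis.
From mathcomp Require Import zify ring lra.

Set Implicit Arguments.
Unset Strict Implicit.
Unset Printing Implicit Defensive.

Import Order.TTheory GRing.Theory Num.Theory.
Import numFieldNormedType.Exports.

Local Open Scope ring_scope.

(** * Recursiveness of Q *)

Section Recursive.
Local Open Scope nat_scope.

Lemma recursive_ext n (f g : n.-tuple nat -> nat) :
  recursive f -> f =1 g -> recursive g.
Proof. by move=> rf /funext <-. Qed.

Lemma recursive_head n : recursive (fun x : n.+1.-tuple nat => thead x).
Proof. exact: recursive_proj. Qed.

Lemma recursive_behead n (f : n.-tuple nat -> nat) :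
  recursive f -> recursive (fun x : n.+1.-tuple nat => f (behead_tuple x)).
Proof.
move=> rf.
have := @recursive_comp n n.+1 f (fun i x => tnth x (lift ord0 i)) rf
  (fun i => recursive_proj _).
move=> /recursive_ext; apply => x; congr f; apply: eq_from_tnth => i.
by rewrite tnth_mktuple tnth_behead; congr tnth; apply: val_inj; rewrite /= inordK // ltnS.
Qed.

Lemma recursive_app1 (F : nat -> nat) n (f : n.-tuple nat -> nat) :
  recursive1 F -> recursive f -> recursive (fun x => F (f x)).
Proof.
move=> rF rf; have := @recursive_comp 1 n _ (fun=> f) rF (fun=> rf).
by move=> /recursive_ext; apply => x; rewrite tnth_mktuple.
Qed.

Lemma recursive_succn n (f : n.-tuple nat -> nat) :
  recursive f -> recursive (fun x => (f x).+1).
Proof. by apply: recursive_app1; exact: recursive_succ. Qed.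

Lemma recursive_const n (c : nat) : recursive (fun _ : n.-tuple nat => c).
Proof.
by elim: c => [|c IH]; [exact: recursive_zero|exact: recursive_succn].
Qed.

(** Primitive recursion runs on the first argument of the auxiliary [h], into which [g x] is then
    substituted. Later closure lemmas can thus speak of functions of [x] rather than of extended
    tuples. *)
Lemma recursive_iter n (F : nat -> nat -> n.-tuple nat -> nat)
    (f g : n.-tuple nat -> nat) :
  recursive (fun y : n.+2.-tuple nat =>
    F (thead y) (thead (behead_tuple y)) (behead_tuple (behead_tuple y))) ->
  recursive f -> recursive g ->
  recursive (fun x => iteri (g x) (fun k acc => F k acc x) (f x)).
Proof.
move=> rF rf rg.
have behK (k : nat) m (x : m.-tuple nat) : behead_tuple [tuple of k :: x] = x.
  exact: val_inj.
pose h (y : n.+1.-tuple nat) :=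
  iteri (thead y) (fun k acc => F k acc (behead_tuple y)) (f (behead_tuple y)).
have rh : recursive h.
  apply: (recursive_primrec rf rF).
    by move=> x; rewrite /h behK theadE.
  by move=> k x; rewrite /h !behK !theadE /=.
pose G (i : 'I_n.+1) (x : n.-tuple nat) := tnth [tuple of g x :: x] i.
have := @recursive_comp n.+1 n h G rh.
have rG i : recursive (G i).
  rewrite /G; case: (unliftP ord0 i) => [j|] ->.
    apply: recursive_ext (recursive_proj j) _ => x.
    by rewrite tnthS.
  by apply: recursive_ext rg _ => x; rewrite tnth0.
move=> /(_ rG); move=> /recursive_ext; apply => x.
have -> : [tuple G i x | i < n.+1] = [tuple of g x :: x].
  by apply: eq_from_tnth => i; rewrite tnth_mktuple.
by rewrite /h behK theadE.
Qed.

Lemma recursive_add n (f g : n.-tuple nat -> nat) :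
  recursive f -> recursive g -> recursive (fun x => f x + g x).
Proof.
move=> rf rg.
have := @recursive_iter n (fun _ a _ => a.+1) f g _ rf rg.
move=> /(_ _)/recursive_ext; apply.
  by apply: recursive_succn; apply: recursive_behead; exact: recursive_head.
by move=> x; elim: (g x) => [|k IH] /=; rewrite ?addn0 // IH addnS.
Qed.

Lemma recursive_sum n (F : nat -> n.-tuple nat -> nat) (g : n.-tuple nat -> nat) :
  recursive (fun y : n.+1.-tuple nat => F (thead y) (behead_tuple y)) ->
  recursive g -> recursive (fun x => \sum_(i < g x) F i x).
Proof.
move=> rF rg.
have := @recursive_iter n (fun k a x => a + F k x) (fun=> 0) g _
  (recursive_const n 0) rg.
move=> /(_ _)/recursive_ext; apply.
  apply: recursive_add.
    by apply: recursive_behead; exact: recursive_head.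
  (* [F] does not see the accumulator: [G] drops the second of the arguments [k, acc, x]. *)
  pose G (i : 'I_n.+1) (y : n.+2.-tuple nat) :=
    tnth [tuple of thead y :: behead_tuple (behead_tuple y)] i.
  have rG i : recursive (G i).
    rewrite /G; case: (unliftP ord0 i) => [j|] ->.
      apply: recursive_ext (recursive_behead (recursive_behead (recursive_proj j))) _.
      by move=> x; rewrite tnthS.
    by apply: recursive_ext (recursive_head _) _ => x; rewrite tnth0.
  apply: recursive_ext (recursive_comp rF rG) _ => y.
  have -> : [tuple G i y | i < n.+1] =
      [tuple of thead y :: behead_tuple (behead_tuple y)].
    by apply: eq_from_tnth => i; rewrite tnth_mktuple.
  by rewrite theadE; congr F; exact: val_inj.
move=> x; elim: (g x) => [|k IH] /=; first by rewrite big_ord0.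
by rewrite big_ord_recr /= IH.
Qed.

Lemma recursive_mul n (f g : n.-tuple nat -> nat) :
  recursive f -> recursive g -> recursive (fun x => f x * g x).
Proof.
move=> rf rg; have := @recursive_sum n (fun _ => f) g _ rg.
move=> /(_ _)/recursive_ext; apply; first exact: recursive_behead.
by move=> x; rewrite sum_nat_const card_ord mulnC.
Qed.

Lemma recursive_exp n (f g : n.-tuple nat -> nat) :
  recursive f -> recursive g -> recursive (fun x => f x ^ g x).
Proof.
move=> rf rg.
have := @recursive_iter n (fun _ a x => a * f x) (fun=> 1) g _
  (recursive_const n 1) rg.
move=> /(_ _)/recursive_ext; apply.
  apply: recursive_mul; last exact: (recursive_behead (recursive_behead rf)).
  by apply: recursive_behead; exact: recursive_head.
by move=> x; elim: (g x) => [|k IH] //=; rewrite IH expnSr.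
Qed.

Lemma recursive_sub n (f g : n.-tuple nat -> nat) :
  recursive f -> recursive g -> recursive (fun x => f x - g x).
Proof.
move=> rf rg.
(* An iteration that returns its own index ends with [x - 1], or with the start value 0 when
   [x = 0]. *)
have rpred : recursive1 predn.
  have := @recursive_iter 1 (fun k _ _ => k) (fun=> 0) (fun x => thead x)
    (recursive_head _) (recursive_const 1 0) (recursive_head _).
  by move=> /recursive_ext; apply => x; rewrite /thead; case: (tnth x ord0).
have := @recursive_iter n (fun _ a _ => a.-1) f g _ rf rg.
move=> /(_ _)/recursive_ext; apply.
  apply: (recursive_app1 rpred).
  by apply: recursive_behead; exact: recursive_head.
by move=> x; elim: (g x) => [|k IH] /=; rewrite ?subn0 // IH subnS.
Qed.

Lemma recursive_leq n (f g : n.-tuple nat -> nat) :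
  recursive f -> recursive g -> recursive (fun x => (f x <= g x)%N : nat).
Proof.
move=> rf rg.
have := recursive_sub (recursive_const n 1) (recursive_sub rf rg).
by move=> /recursive_ext; apply => x; rewrite /leq; case: (f x - g x) => [|[]].
Qed.

Lemma recursive_div n (f g : n.-tuple nat -> nat) :
  recursive f -> recursive g -> recursive (fun x => f x %/ g x).
Proof.
move=> rf rg.
(* For [g x > 0] the quotient is the number of positive multiples of [g x] up to [f x]. At [g x = 0]
   this sum would be [f x], so a factor [1 <= g x] restores the value 0. *)
have rs : recursive (fun x => \sum_(i < f x) (i.+1 * g x <= f x)).
  apply: (@recursive_sum n (fun i x => i.+1 * g x <= f x) f _ rf).
  apply: recursive_leq (recursive_behead rf).
  apply: recursive_mul (recursive_behead rg).
  by apply: recursive_succn; exact: recursive_head.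
have /recursive_ext := recursive_mul (recursive_leq (recursive_const n 1) rg) rs.
apply; move=> x; case: (posnP (g x)) => [->|g0]; first by rewrite divn0.
rewrite mul1n; under eq_bigr do rewrite -leq_divRL //.
have : f x %/ g x <= f x by exact: leq_div.
move: (f x %/ g x) => q; move: (f x) => m qm.
rewrite -{2}(minn_idPl qm); elim: m {qm} => [|m IH]; first by rewrite big_ord0 minn0.
by rewrite big_ord_recr /= IH; case: ltnP; lia.
Qed.

Lemma recursive_least n (F : nat -> n.-tuple nat -> nat) (h : n.-tuple nat -> nat) :
  recursive (fun y : n.+1.-tuple nat => F (thead y) (behead_tuple y)) ->
  (forall x, F (h x) x = 0) ->
  (forall x k, k < h x -> F k x <> 0) -> recursive h.
Proof.
move=> rF F0 Fn; have behK (k : nat) m (x : m.-tuple nat) :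
  behead_tuple [tuple of k :: x] = x by exact: val_inj.
by apply: (recursive_min rF) => x; [|move=> k]; rewrite theadE behK; [|exact: Fn].
Qed.

Lemma eq_bits m (x y : nat) : x < 2 ^ m -> y < 2 ^ m ->
  (forall a, a < m -> odd (x %/ 2 ^ a) = odd (y %/ 2 ^ a)) -> x = y.
Proof.
elim: m x y => [|m IH] x y; first by rewrite !ltnS !leqn0 => /eqP-> /eqP->.
move=> xm ym xy.
have xy0 : odd x = odd y by have := xy 0 isT; rewrite !divn1.
suff e : x./2 = y./2 by rewrite -[x]odd_double_half -[y]odd_double_half xy0 e.
apply: IH; rewrite -?divn2 ?ltn_divLR -?expnSr // => a am.
by rewrite -!divnMA -expnS; exact: xy.
Qed.

(** Binary coding turns a count of sets into a bounded sum over their codes. *)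
Definition bitset n (x : 'I_(2 ^ n)) : {set 'I_n} := [set a : 'I_n | odd (x %/ 2 ^ a)].

Lemma bitset_bij n : bijective (@bitset n).
Proof.
apply: inj_card_bij; last by rewrite -cardsT -powersetT card_powerset cardsT !card_ord.
move=> x y /setP xy; apply: val_inj; apply: (@eq_bits n) => [||a an]; [exact: ltn_ord..|].
by have := xy (Ordinal an); rewrite !inE.
Qed.

(* Nonzero exactly when [a] and [b] lie in the set coded by [x] and either [a = 0]
   or [a] is a proper divisor of [b]. *)
Definition conflict (x a b : nat) : nat :=
  (x %/ 2 ^ a - x %/ 2 ^ a %/ 2 * 2) * (x %/ 2 ^ b - x %/ 2 ^ b %/ 2 * 2) *
  ((a <= 0)%N + ((a.+1 <= b) * (b <= b %/ a * a)))%N.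

Definition conflicts (n x : nat) : nat :=
  \sum_(a < n.+1) \sum_(b < n.+1) conflict x a b.

(** Truncated subtraction from 1 is the indicator of having no conflict. The diagonal pairs [a = b]
    only test whether 0 lies in the set. *)
Lemma conflicts_primitive n (x : 'I_(2 ^ n.+1)) :
  1 - conflicts n x = (primitive (bitset x)) :> nat.
Proof.
have bitE y : y - y %/ 2 * 2 = odd y by rewrite {1}(divn_eq y 2) addKn modn2.
suff <- : (conflicts n x == 0) = primitive (bitset x).
  by case: (conflicts n x) => [|[]].
rewrite /conflicts /conflict; apply/idP/idP.
  rewrite sum_nat_eq0 => /forallP H.
  have {}H (a b : 'I_n.+1) : a \in bitset x -> b \in bitset x ->
      (a <= 0)%N + ((a.+1 <= b) * (b <= b %/ a * a)) = 0.
    rewrite !inE => ax bx; have /= := H a; rewrite sum_nat_eq0 => /forallP/(_ b)/=.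
    by rewrite !bitE ax bx !mul1n => /eqP.
  apply/andP; split.
    apply/forallP => a; apply/implyP => aA; have := H a a aA aA.
    by rewrite leqn0; case: (posnP a) => // ->.
  apply/forallP => a; apply/implyP => aA; apply/forallP => b; apply/implyP => bA.
  apply/implyP => ab; apply/negP => dab; have := H a b aA bA.
  rewrite leqn0 divnK // leqnn muln1 => /eqP; rewrite addn_eq0 => /andP[a0].
  case: (posnP a) a0 => // a_gt0 _; rewrite ltn_neqAle ab /=.
  have /= b0 := H b b bA bA.
  have b_gt0 : 0 < b by move: b0; rewrite leqn0; case: (posnP b) => // ->.
  by rewrite dvdn_leq.
move=> /andP[/forallP H1 /forallP H2].
rewrite sum_nat_eq0; apply/forallP => a /=; rewrite sum_nat_eq0; apply/forallP => b /=.
rewrite !bitE; have := H1 a; have := H2 a; rewrite inE.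
case: (odd _) => //= /forallP/(_ b); rewrite inE; case: (odd _) => //= ab a0.
rewrite !mul1n leqNgt a0 add0n.
case: ltnP => // ltab; rewrite mul1n eqb0 -ltnNge.
move: ab; rewrite -val_eqE neq_ltn ltab /= => /negP nd.
rewrite ltn_neqAle leq_trunc_div andbT.
by apply/negP; rewrite -dvdn_eq.
Qed.

Lemma Q_conflicts n : Q n = \sum_(x < 2 ^ n.+1) (1 - conflicts n x).
Proof.
rewrite /Q -sum1_card big_mkcond /=.
rewrite (reindex (@bitset n.+1)); last by apply: onW_bij; exact: bitset_bij.
by apply: eq_bigr => x _; rewrite inE conflicts_primitive; case: primitive.
Qed.

Lemma recursive_Q : recursive1 Q.
Proof.
rewrite /recursive1 (funext (fun x : 1.-tuple nat => Q_conflicts (tnth x ord0))).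
rewrite /conflicts; have rh := recursive_head; have rc := recursive_const.
have rx : recursive (fun x : 1.-tuple nat => (tnth x ord0).+1).
  by apply: recursive_succn; exact: rh.
apply: (@recursive_sum 1 (fun x y => 1 - \sum_(a < (tnth y ord0).+1)
    \sum_(b < (tnth y ord0).+1) conflict x a b) _ _ (recursive_exp (rc 1 2) rx)).
apply: recursive_sub => //.
apply: (@recursive_sum 2 (fun a y => \sum_(b < (tnth (behead_tuple y) ord0).+1)
    conflict (thead y) a b) _ _ (recursive_behead rx)).
apply: (@recursive_sum 3
    (fun b y => conflict (thead (behead_tuple y)) (thead y) b) _ _
    (recursive_behead (recursive_behead rx))).
rewrite /conflict.
(* Each nested sum has put its index in front: the arguments are now [b], [a], [x], [n] in this
   order. *)
have rb : recursive (fun y : 4.-tuple nat => thead y) by [].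
have ra : recursive (fun y : 4.-tuple nat => thead (behead_tuple y)).
  exact: (recursive_behead (rh 2)).
have rxx : recursive (fun y : 4.-tuple nat => thead (behead_tuple (behead_tuple y))).
  exact: (recursive_behead (recursive_behead (rh 1))).
have rbit (f : 4.-tuple nat -> nat) : recursive f ->
  recursive (fun y : 4.-tuple nat => thead (behead_tuple (behead_tuple y)) %/ 2 ^ f y -
    thead (behead_tuple (behead_tuple y)) %/ 2 ^ f y %/ 2 * 2).
  move=> rf; have ? := recursive_div rxx (recursive_exp (rc 4 2) rf).
  by apply: recursive_sub => //; apply: recursive_mul => //; exact: recursive_div.
apply: recursive_mul; first by apply: recursive_mul; exact: rbit.
apply: recursive_add; first exact: recursive_leq.
apply: recursive_mul; apply: recursive_leq => //; first exact: recursive_succn.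
by apply: recursive_mul => //; exact: recursive_div.
Qed.

End Recursive.

(** * Independent sets of divisibility relations *)

Lemma leq_card_in_inj (T U : finType) (f : T -> U) (A : {set T}) (B : {set U}) :
  {in A &, injective f} -> {in A, forall x, f x \in B} -> (#|A| <= #|B|)%N.
Proof.
move=> fI fB; rewrite -(card_in_imset fI); apply/subset_leq_card/fintype.subsetP.
by move=> _ /imsetP[x xA ->]; exact: fB.
Qed.

Section Independence.
Local Open Scope nat_scope.
Variable T : finType.
Implicit Types (r : rel T) (X Y A : {set T}).

(** Primitive and [t]-primitive sets are both the independent sets of a relation, so the counting
    lemmas are proved once, for [nind]. *)
Definition independent r A := [forall a in A, forall b in A, ~~ r a b].

Definition nind r X := #|[set A : {set T} | (A \subset X) && independent r A]%SET|.

Lemma independentP r A :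
  reflect {in A &, forall a b, ~~ r a b} (independent r A).
Proof.
apply: (iffP forall_inP) => [H a b aA bA|H a aA].
  by have /forall_inP := H a aA; exact.
by apply/forall_inP => b bA; exact: H.
Qed.

Lemma nind_gt0 r X : 0 < nind r X.
Proof.
apply/card_gt0P; exists finset.set0; rewrite inE finset.sub0set /=.
by apply/independentP => a b; rewrite inE.
Qed.

Lemma nind_sub r X Y : X \subset Y -> nind r X <= nind r Y.
Proof.
move=> XY; apply/subset_leq_card/fintype.subsetP => A; rewrite !inE => /andP[AX ->].
by rewrite (fintype.subset_trans AX XY).
Qed.

Lemma nind_rel r r' X : {in X &, forall x y, r x y -> r' x y} ->
  nind r' X <= nind r X.
Proof.
move=> rr'; apply/subset_leq_card/fintype.subsetP => A; rewrite !inE.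
move=> /andP[AX /independentP iA]; rewrite AX /=.
apply/independentP => a b aA bA; apply: contra (iA a b aA bA).
by apply: rr'; exact: (fintype.subsetP AX).
Qed.

Lemma independent_sub r A (B : {set T}) : A \subset B -> independent r B -> independent r A.
Proof.
move=> /fintype.subsetP AB /independentP iB; apply/independentP => a b aA bA.
by apply: iB; exact: AB.
Qed.

(** An independent subset of the union is determined by its trace on [X], again independent, and its
    trace on [Y], for which there are at most [2 ^ #|Y|] choices. *)
Lemma nindU_le r X Y : nind r (X :|: Y) <= 2 ^ #|Y| * nind r X.
Proof.
rewrite -card_powerset -cardsX.
apply: (@leq_card_in_inj _ _ (fun A => (A :&: Y, A :&: X))%SET).
  move=> A B; rewrite !inE => /andP[AXY _] /andP[BXY _] [eY eX].
  by rewrite -(finset.setIidPl AXY) -(finset.setIidPl BXY) !finset.setIUr eX eY.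
move=> A; rewrite !inE /= => /andP[_ iA]; rewrite !finset.subsetIr /=.
by apply: independent_sub iA; exact: finset.subsetIl.
Qed.

(** With no relation across, the traces on [X] and [Y] can be chosen freely: two independent sets
    always have an independent union. *)
Lemma nindU r X Y : [disjoint X & Y] ->
  (forall x y, x \in X -> y \in Y -> ~~ r x y && ~~ r y x) ->
  nind r (X :|: Y) = nind r X * nind r Y.
Proof.
move=> dXY rXY; rewrite -cardsX; apply/eqP; rewrite eqn_leq; apply/andP; split.
  apply: (@leq_card_in_inj _ _ (fun A => (A :&: X, A :&: Y))%SET).
    move=> A B; rewrite !inE => /andP[AXY _] /andP[BXY _] [eY eX].
    by rewrite -(finset.setIidPl AXY) -(finset.setIidPl BXY) !finset.setIUr eX eY.
  move=> A; rewrite !inE /= => /andP[_ iA]; rewrite !finset.subsetIr /=.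
  by apply/andP; split; apply: independent_sub iA; exact: finset.subsetIl.
apply: (@leq_card_in_inj _ _ (fun p => p.1 :|: p.2)%SET).
  have E A (B : {set T}) : A \subset X -> B \subset Y ->
      ((A :|: B) :&: X)%SET = A /\ ((A :|: B) :&: Y)%SET = B.
    move=> AX BY; rewrite !finset.setIUl (finset.setIidPl AX) (finset.setIidPl BY).
    have -> : (A :&: Y)%SET = finset.set0.
      by apply/eqP; rewrite finset.setI_eq0; exact: disjointWl AX dXY.
    have -> : (B :&: X)%SET = finset.set0.
      apply/eqP; rewrite finset.setI_eq0; apply: disjointWl BY _.
      by rewrite disjoint_sym.
    by rewrite finset.setU0 finset.set0U.
  move=> [A B] [C D]; rewrite !inE /=.
  move=> /andP[/andP[AX _] /andP[BY _]] /andP[/andP[CX _] /andP[DY _]] e.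
  have [eA eB] := E _ _ AX BY; have [eC eD] := E _ _ CX DY.
  by move: eA eB; rewrite e eC eD => <- <-.
move=> [A B]; rewrite !inE /= => /andP[/andP[AX /independentP iA] /andP[BY /independentP iB]].
rewrite finset.setUSS //=; apply/independentP => a b.
rewrite !inE => /orP[aA|aB] /orP[bA|bB].
- exact: iA.
- by case/andP: (rXY a b (fintype.subsetP AX _ aA) (fintype.subsetP BY _ bB)).
- by case/andP: (rXY b a (fintype.subsetP AX _ bA) (fintype.subsetP BY _ aB)).
- exact: iB.
Qed.

End Independence.

Lemma nind_imset (T U : finType) (f : T -> U) (r : rel T) (r' : rel U) (X : {set T}) :
  {in X &, injective f} -> {in X &, forall x y, r' (f x) (f y) = r x y} ->
  nind r' (f @: X)%SET = nind r X.
Proof.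
move=> fI frr'; rewrite /nind.
rewrite -(@card_in_imset _ _ (fun A : {set T} => f @: A)%SET
  [set A : {set T} | (A \subset X) && independent r A]%SET); last first.
  have sub (A B : {set T}) : A \subset X -> B \subset X -> (f @: A = f @: B)%SET ->
      A \subset B.
    move=> /fintype.subsetP AX /fintype.subsetP BX e; apply/fintype.subsetP => x xA.
    have := imset_f f xA; rewrite e => /imsetP[y yB fxy].
    by rewrite (fI _ _ (AX _ xA) (BX _ yB) fxy).
  move=> A B; rewrite !inE => /andP[AX _] /andP[BX _] e.
  by apply/eqP; rewrite finset.eqEsubset (sub A B AX BX e) (sub B A BX AX (esym e)).
congr #|pred_of_set _|; apply/finset.setP => B; rewrite !inE; apply/andP/imsetP.
  move=> [BX /independentP iB].
  exists [set x in X | f x \in B]%SET.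
    rewrite inE; apply/andP; split.
      by apply/fintype.subsetP => x; rewrite inE => /andP[].
    apply/independentP => a b; rewrite !inE => /andP[aX fa] /andP[bX fb].
    by rewrite -frr' //; exact: iB.
  apply/finset.setP => y; apply/idP/imsetP => [yB|[x]]; last first.
    by rewrite inE => /andP[_ fx] ->.
  have /imsetP[x xX e] := fintype.subsetP BX _ yB.
  by exists x => //; rewrite inE xX -e.
move=> [A + ->]; rewrite inE => /andP[AX /independentP iA].
split; first exact: imsetS.
apply/independentP => _ _ /imsetP[a aA ->] /imsetP[b bA ->].
by rewrite frr' ?iA //; exact: (fintype.subsetP AX).
Qed.

(** * Sets that are primitive for smooth quotients *)

Section Smooth.
Local Open Scope nat_scope.

(** Taken as a set of primes, so that [.-nat] at it means [t]-smooth, [.-nat] at its complement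
    means [t]-rough, and the parts of [n] at the two are its smooth and rough parts. *)
Definition le_pred (t : nat) : nat_pred := [pred p | p <= t].

Definition smooth_dvd (t : nat) (a b : nat) :=
  [&& a != b, a %| b & (le_pred t).-nat (b %/ a)].

Section Bounded.
Variables (N t : nat).
Notation pi := (le_pred t).

Definition smooth_dvd_ord : rel 'I_N.+1 := fun a b => smooth_dvd t a b.

(** One ambient type ['I_N.+1] serves all ranges up to [N], so that counts for different ranges are
    comparable; the range is encoded in [P]. *)
Definition nsmooth_primitive (P : pred nat) :=
  nind smooth_dvd_ord [set a : 'I_N.+1 | (0 < a) && P a]%SET.

Lemma smooth_dvd_scale s a b : 0 < s ->
  smooth_dvd t (s * a) (s * b) = smooth_dvd t a b.
Proof.
by move=> s0; rewrite /smooth_dvd eqn_pmul2l // dvdn_pmul2l // divnMl.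
Qed.

(** A smooth quotient leaves the rough part unchanged, so the relation only joins integers with
    equal rough parts. *)
Lemma smooth_dvd_part a b : 0 < b -> smooth_dvd t a b -> a`_pi^' = b`_pi^'.
Proof.
move=> b0 /and3P[_ ab sab]; have a0 : 0 < a by case: a ab {sab} => //; rewrite dvd0n eqn0Ngt b0.
rewrite -(divnK ab) partnM //; last by rewrite divn_gt0 // dvdn_leq.
by rewrite (@part_p'nat _ (b %/ a)) ?mul1n // pnatNK.
Qed.

(* Multiplication by [s] carries the smooth numbers onto the integers of rough part [s]. *)
Lemma nsmooth_primitive_scale s m (P : pred nat) :
  pi^'.-nat s -> s * m <= N -> (forall d, P d -> d <= m) ->
  nsmooth_primitive (fun a => (a`_pi^' == s) && P a`_pi) =
  nsmooth_primitive (fun d => pi.-nat d && P d).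
Proof.
move=> rs smN Pm; have s0 : 0 < s by case/andP: rs.
have sN d : P d -> s * d < N.+1.
  by move=> /Pm dm; rewrite ltnS (leq_trans _ smN) // leq_mul2l dm orbT.
rewrite /nsmooth_primitive -(@nind_imset _ _ (fun d : 'I_N.+1 => inord (s * d) : 'I_N.+1)
  smooth_dvd_ord smooth_dvd_ord [set a : 'I_N.+1 | (0 < a) && (pi.-nat a && P a)]%SET);
  last 2 first.
- move=> x y; rewrite !inE => /and3P[_ _ Px] /and3P[_ _ Py] /(congr1 val) /=.
  rewrite !inordK ?sN // => /eqP; rewrite eqn_pmul2l // => /eqP; exact: val_inj.
- move=> x y; rewrite !inE => /and3P[_ _ Px] /and3P[_ _ Py].
  by rewrite /smooth_dvd_ord !inordK ?sN // smooth_dvd_scale.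
congr nind; apply/finset.setP => a; rewrite inE; apply/idP/imsetP.
  move=> /and3P[a0 /eqP as_ Pa]; have dN : a`_pi < N.+1.
    by apply: leq_trans (ltn_ord a); rewrite ltnS dvdn_leq // dvdn_part.
  exists (inord a`_pi); first by rewrite inE inordK // part_gt0 part_pnat.
  by apply: val_inj; rewrite inordK // -as_ mulnC partnC //= inord_val.
move=> [d]; rewrite inE => /and3P[d0 sd Pd] ->; rewrite inordK ?sN //.
rewrite muln_gt0 s0 d0 /= !partnM // (part_pnat_id rs) (part_pnat_id sd).
by rewrite part_p'nat ?pnatNK // part_p'nat // mul1n muln1 eqxx.
Qed.

Lemma nsmooth_primitiveS k : 0 < k <= N ->
  nsmooth_primitive (fun a => a <= k) *
    nsmooth_primitive (fun d => pi.-nat d && (d < k`_pi)) =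
  nsmooth_primitive (fun a => a < k) *
    nsmooth_primitive (fun d => pi.-nat d && (d <= k`_pi)).
Proof.
move=> /andP[k0 kN]; set m := k`_pi; set s := k`_pi^'.
have ksm : k = s * m by rewrite mulnC partnC.
have rs : pi^'.-nat s by exact: part_pnat.
have s0 : 0 < s by exact: part_gt0.
have split_ (P : pred nat) : nsmooth_primitive P =
    nsmooth_primitive (fun a => (a`_pi^' == s) && P a) *
    nsmooth_primitive (fun a => (a`_pi^' != s) && P a).
  rewrite /nsmooth_primitive -nindU.
  - congr nind; apply/finset.setP => a; rewrite !inE.
    by case: (0 < a); case: (P a); case: eqP.
  - rewrite disjoint_subset; apply/fintype.subsetP => a; rewrite !inE.
    by case/and3P=> _ -> _; rewrite andbF.
  - move=> x y; rewrite !inE => /and3P[x0 /eqP xs _] /and3P[y0 ys _].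
    rewrite /smooth_dvd_ord; apply/andP; split; apply/negP => /smooth_dvd_part.
      by move=> /(_ y0) e; rewrite -e xs eqxx in ys.
    by move=> /(_ x0) e; rewrite e xs eqxx in ys.
have part_le a : 0 < a -> a`_pi^' == s -> (a <= k) = (a`_pi <= m).
  by move=> a0 /eqP as_; rewrite -{1}(partnC pi a0) as_ ksm mulnC leq_pmul2l.
have part_lt a : 0 < a -> a`_pi^' == s -> (a < k) = (a`_pi < m).
  by move=> a0 /eqP as_; rewrite -{1}(partnC pi a0) as_ ksm mulnC ltn_pmul2l.
rewrite (split_ (fun a => a <= k)) (split_ (fun a => a < k)).
rewrite -(@nsmooth_primitive_scale s m (fun d => d < m)) -?ksm //; last by move=> d /ltnW.
rewrite -(@nsmooth_primitive_scale s m (fun d => d <= m)) -?ksm //.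
rewrite mulnAC; have -> : nsmooth_primitive (fun a => (a`_pi^' == s) && (a <= k)) =
    nsmooth_primitive (fun a => (a`_pi^' == s) && (a`_pi <= m)).
  congr nind; apply/finset.setP => a; rewrite !inE; case: posnP => //= a0.
  by case: (boolP (_ == s)) => //= as_; rewrite part_le.
have -> : nsmooth_primitive (fun a => (a`_pi^' == s) && (a < k)) =
    nsmooth_primitive (fun a => (a`_pi^' == s) && (a`_pi < m)).
  congr nind; apply/finset.setP => a; rewrite !inE; case: posnP => //= a0.
  by case: (boolP (_ == s)) => //= as_; rewrite part_lt.
(* [k] itself has rough part [s], so it is absent from the other classes. *)
have -> : nsmooth_primitive (fun a => (a`_pi^' != s) && (a <= k)) =
    nsmooth_primitive (fun a => (a`_pi^' != s) && (a < k)).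
  congr nind; apply/finset.setP => a; rewrite !inE; case: posnP => //= a0.
  case: (boolP (_ == s)) => //= as_; rewrite (leq_eqVlt a).
  by case: (nat_of_ord a =P k) as_ => [->|//]; rewrite eqxx.
by rewrite [in RHS]mulnAC mulnC [in RHS]mulnC; ring.
Qed.

End Bounded.

End Smooth.

(** * Smooth and rough parts *)

Section Sieve.
Local Open Scope nat_scope.

Lemma sum_dvdn (V : nmodType) (g : nat -> V) j n : 0 < j ->
  (\sum_(1 <= k < n.+1 | (j %| k)%N) g (k %/ j)%N = \sum_(1 <= s < (n %/ j).+1) g s)%R.
Proof.
move=> j0; elim: n => [|n IH]; first by rewrite div0n !big_nil.
rewrite big_mkcond big_nat_recr //= -big_mkcond IH divnS //.
by case: (j %| n.+1); rewrite ?addr0 ?add0n // add1n [RHS]big_nat_recr.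
Qed.

Lemma le_predS_nonprime t n : ~~ prime t.+1 ->
  (le_pred t.+1).-nat n = (le_pred t).-nat n.
Proof.
move=> np; apply: eq_in_pnat => p; rewrite !inE mem_primes => /and3P[pp _ _].
by rewrite leq_eqVlt; case: eqP => // ep; rewrite -ep pp in np.
Qed.

Lemma le_pred'S_nonprime t n : ~~ prime t.+1 ->
  (le_pred t.+1)^'.-nat n = (le_pred t)^'.-nat n.
Proof.
move=> np; apply: eq_in_pnat => p; rewrite !inE mem_primes => /and3P[pp _ _].
by rewrite leq_eqVlt; case: eqP => // ep; rewrite -ep pp in np.
Qed.

Lemma le_pred'S_prime t n : prime t.+1 -> 0 < n ->
  (le_pred t.+1)^'.-nat n = (le_pred t)^'.-nat n && ~~ (t.+1 %| n).
Proof.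
move=> pp n0; apply/(pnatP _ n0)/andP => [H|[/(pnatP _ n0) H nd] q qp qn].
  split; last by apply/negP => /(H _ pp); rewrite !inE leqnn.
  apply/(pnatP _ n0) => q qp qn; have := H q qp qn; rewrite !inE.
  by apply: contra => /leq_trans; apply.
have := H q qp qn; rewrite !inE (leq_eqVlt q t.+1) ltnS.
by case: eqP => // qt; rewrite -qt qn in nd.
Qed.

Lemma le_predS_ndvd t n : ~~ (t.+1 %| n) ->
  (le_pred t.+1).-nat n = (le_pred t).-nat n.
Proof.
move=> nd; apply: eq_in_pnat => p; rewrite !inE mem_primes => /and3P[pp _ pn].
by rewrite leq_eqVlt; case: eqP => // ep; rewrite -ep pn in nd.
Qed.

Lemma le_predS_dvd t n : prime t.+1 -> t.+1 %| n ->
  (le_pred t.+1).-nat n = (le_pred t.+1).-nat (n %/ t.+1).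
Proof.
move=> pp dn; rewrite -{1}(divnK dn) pnatM [X in _ && X]pnatE //.
by rewrite !inE leqnn andbT.
Qed.

Definition nrough t m : nat := \sum_(1 <= k < m.+1) (le_pred t)^'.-nat k.

Lemma nrough0 m : nrough 0 m = m.
Proof.
rewrite /nrough big_nat (eq_bigr (fun=> 1)); last first.
  move=> k /andP[k0 _]; have -> // : (le_pred 0)^'.-nat k.
  by apply/(pnatP _ k0) => p pp _; rewrite !inE -ltnNge prime_gt0.
by rewrite -big_nat big_const_nat iter_addn addn0 mul1n subn1.
Qed.

Lemma nroughS_nonprime t m : ~~ prime t.+1 -> nrough t.+1 m = nrough t m.
Proof. by move=> np; apply: eq_bigr => k _; rewrite le_pred'S_nonprime. Qed.

(** Legendre's recursion: among the [t]-rough integers, those divisible by the prime [t.+1] are its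
    multiples by [t]-rough cofactors. *)
Lemma nroughS_prime t m : prime t.+1 ->
  nrough t m = nrough t.+1 m + nrough t (m %/ t.+1).
Proof.
move=> pp; rewrite {1}/nrough (bigID (fun k => t.+1 %| k)) /= addnC; congr (_ + _).
  rewrite /nrough [RHS]big_nat big_mkcond big_nat; apply: eq_bigr => k /andP[k0 _].
  by rewrite le_pred'S_prime //; case: (t.+1 %| k); rewrite ?andbF ?andbT.
rewrite /nrough -(@sum_dvdn _ (fun k => (le_pred t)^'.-nat k : nat)) //.
apply: eq_bigr => k dk; congr nat_of_bool.
rewrite -{1}(divnK dk) pnatM [X in _ && X]pnatE // !inE.
by rewrite -ltnNge leqnn andbT.
Qed.

End Sieve.

(** * Sieve errors and smooth sums for a completely multiplicative weight *)

Section Density.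
Variables (R : realFieldType) (w : nat -> R).
Hypotheses (w_ge0 : forall a, 0 <= w a) (w1 : w 1 = 1)
  (wM : forall a b, w (a * b)%N = w a * w b).

(** Induction along Legendre's recursion: sieving by a prime [p] adds the error at [j * p] to the
    one at [j], which multiplies the bound by [1 + w p]. *)
Lemma nrough_density (c : R) (n N : nat) : 
  (forall j, (0 < j)%N -> `|(N %/ j)%:R / N%:R - (n %/ j)%:R / n%:R| <= c * w j) ->
  forall t j, (0 < j)%N ->
  `|(nrough t (N %/ j))%:R / N%:R - (nrough t (n %/ j))%:R / n%:R| <=
    c * w j * \prod_(0 <= p < t.+1 | prime p) (1 + w p).
Proof.
move=> H; elim=> [|t IH] j j0.
  by rewrite !nrough0 big_mkcond big_nat1 mulr1; exact: H.
rewrite big_mkcond big_nat_recr //= -big_mkcond /=.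
have [pp|np] := ifPn; last by rewrite !nroughS_nonprime // mulr1; exact: IH.
have E m : (nrough t.+1 m)%:R = (nrough t m)%:R - (nrough t (m %/ t.+1))%:R :> R.
  by rewrite (nroughS_prime m pp) natrD addrK.
rewrite !E !mulrBl -!divnMA.
have -> : forall a b d e : R, a - b - (d - e) = (a - d) - (b - e) by move=> *; ring.
apply: (le_trans (ler_normB _ _)).
rewrite mulrDr mulr1 mulrDr; apply: lerD; first exact: IH.
apply: (le_trans (IH _ _)); first by rewrite muln_gt0 j0.
by rewrite wM le_eqVlt; apply/orP; left; apply/eqP; ring.
Qed.

(** A finite Euler product. If [S] is the sum for the next prime [p], the multiples of [p]
    contribute at most [w p * S], so [S * (1 - w p)] is bounded by the previous sum. *)
Lemma sum_smooth_le (t N : nat) : (forall p, prime p -> w p < 1) ->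
  \sum_(1 <= j < N.+1 | (le_pred t).-nat j) w j <=
    \prod_(0 <= p < t.+1 | prime p) (1 - w p)^-1.
Proof.
move=> wlt1; elim: t N => [|t IH] N.
  rewrite [X in _ <= X]big_mkcond big_nat1.
  case: N => [|N]; first by rewrite big_nil.
  rewrite big_ltn_cond // /= w1 big_nat_cond big_pred0 ?addr0 // => k.
  apply/negbTE/negP => /andP[/andP[k1 _] sk]; have k0 := ltnW k1.
  have := (pnatP _ k0 sk) _ (pdiv_prime k1) (pdiv_dvd k).
  by rewrite inE leqn0 => /eqP e; have := pdiv_gt0 k; rewrite e.
rewrite [X in _ <= X]big_mkcond big_nat_recr //= -big_mkcond /=.
have [pp|np] := ifPn; last first.
  by rewrite mulr1; under eq_bigl do rewrite le_predS_nonprime //; exact: IH.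
rewrite ler_pdivlMr ?subr_gt0 ?wlt1 // mulrBr mulr1.
apply: le_trans (IH N); rewrite lerBlDr.
rewrite [X in X <= _](bigID (fun k => t.+1 %| k)%N) /= [X in X <= _]addrC; apply: lerD.
  rewrite big_mkcond [X in _ <= X]big_mkcond; apply: ler_sum => k _.
  case: (boolP (t.+1 %| k)%N) => [_|nd]; first by rewrite andbF; case: ifP.
  by rewrite andbT le_predS_ndvd.
pose g k := if (le_pred t.+1).-nat k then w k else 0.
have -> : \sum_(1 <= i < N.+1 | ((le_pred t.+1).-nat i) && (t.+1 %| i)%N) w i =
    \sum_(1 <= i < N.+1 | (t.+1 %| i)%N) w t.+1 * g (i %/ t.+1)%N.
  rewrite big_mkcond [RHS]big_mkcond; apply: eq_bigr => k _.
  case: (boolP (t.+1 %| k)%N) => [dk|_]; last by rewrite andbF.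
  rewrite andbT /g (le_predS_dvd pp dk); case: ifP => _; last by rewrite mulr0.
  by rewrite -wM mulnC divnK.
rewrite -mulr_sumr (@sum_dvdn _ g) // mulrC ler_wpM2r // [X in _ <= X]big_mkcond.
rewrite [X in _ <= X](@big_cat_nat _ _ _ (N %/ t.+1).+1) //=; last first.
  by rewrite ltnS leq_div.
by rewrite lerDl sumr_ge0 // => k _; case: ifP.
Qed.

End Density.

(** * The logarithmic count as a sum over smooth numbers *)

Section LogCount.
Variables (R : realType) (N t : nat).
Notation pi := (le_pred t).

Definition lncount (P : pred nat) : R := ln (nsmooth_primitive N t P)%:R.

(** The amount by which every integer with smooth part [j] increases the logarithmic count. *)
Definition lnjump (j : nat) : R :=
  lncount (fun d => pi.-nat d && (d <= j)%N) - lncount (fun d => pi.-nat d && (d < j)%N).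

Lemma natr_nind_gt0 (T : finType) (r : rel T) X : 0 < (nind r X)%:R :> R.
Proof. by rewrite ltr0n nind_gt0. Qed.

Lemma lnjump_ge0 j : 0 <= lnjump j.
Proof.
rewrite subr_ge0 ler_ln ?posrE ?natr_nind_gt0 // ler_nat.
apply/nind_sub/fintype.subsetP => a; rewrite !inE => /and3P[-> -> /ltnW]; exact.
Qed.

(** Admitting one more element at most doubles the number of independent sets. *)
Lemma lnjump_le j : lnjump j <= ln 2.
Proof.
rewrite lerBlDr -lnM ?posrE ?natr_nind_gt0 // ler_ln ?posrE ?natr_nind_gt0 //; last first.
  by rewrite mulr_gt0 // natr_nind_gt0.
rewrite -natrM ler_nat.
set X := [set a : 'I_N.+1 | (0 < a)%N && (pi.-nat a && (a < j)%N)]%SET.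
set Y := [set a : 'I_N.+1 | a == j :> nat]%SET.
apply: (@leq_trans (nind (@smooth_dvd_ord N t) (X :|: Y)%SET)).
  apply/nind_sub/fintype.subsetP => a; rewrite !inE => /and3P[-> -> ].
  by rewrite leq_eqVlt orbC.
apply: (leq_trans (nindU_le _ _ _)); rewrite leq_mul2r; apply/orP; right.
rewrite -[X in (_ <= X)%N](expn1 2) leq_exp2l //.
apply/fintype.card_le1P => a; rewrite inE => /eqP aj b; rewrite !inE -val_eqE.
by rewrite -aj.
Qed.

(** Telescoping of [nsmooth_primitiveS], starting from the empty range, whose only independent set
    is empty. *)
Lemma lncount_sum n : (n <= N)%N ->
  lncount (fun a => (a <= n)%N) = \sum_(1 <= k < n.+1) lnjump k`_pi.
Proof.
elim: n => [|n IH] nN.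
  rewrite big_nil /lncount /nsmooth_primitive; set X := finset _.
  have -> : X = finset.set0.
    by apply/finset.setP => a; rewrite !inE; case: (val a).
  have -> : nind (@smooth_dvd_ord N t) finset.set0 = 1%N.
    apply/eqP; rewrite eqn_leq nind_gt0 andbT.
    apply: leq_trans (_ : #|[set finset.set0 : {set 'I_N.+1}]%SET| <= _)%N.
      apply/subset_leq_card/fintype.subsetP => A.
      by rewrite !inE finset.subset0 => /andP[].
    by rewrite cards1.
  by rewrite ln1.
rewrite big_nat_recr //= -IH; last exact: ltnW.
have /(congr1 (fun k => ln k%:R : R)) := @nsmooth_primitiveS N t n.+1 nN.
rewrite !natrM !lnM ?posrE ?natr_nind_gt0 // /lnjump /lncount.
set A := ln _; set B := ln _; set C := ln _; set D := ln _ => e.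
by rewrite addrA; apply/eqP; rewrite eq_sym subr_eq; apply/eqP; rewrite e.
Qed.

Lemma nrough_sum n j : (0 < j)%N -> pi.-nat j ->
  (nrough t (n %/ j) = \sum_(1 <= k < n.+1) (k`_pi == j))%N.
Proof.
move=> j0 sj; rewrite /nrough -(@sum_dvdn _ (fun k => pi^'.-nat k : nat)) //.
rewrite big_mkcond big_nat [RHS]big_nat; apply: eq_bigr => k /andP[k0 kn].
case: (boolP (j %| k)%N) => [jk|njk]; last first.
  by case: eqP => // e; rewrite -e dvdn_part in njk.
rewrite -{2}(divnK jk) partnM //; last by rewrite divn_gt0 // dvdn_leq.
rewrite (part_pnat_id sj) -[X in _ == X]mul1n eqn_pmul2r // partn_eq1 //.
by rewrite divn_gt0 // dvdn_leq.
Qed.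

(** Groups the integers up to [n] by smooth part. The sum runs to [N] and not to [n], the added
    terms being 0 since [n %/ j = 0]; two values of [n] can then be compared term by term. *)
Lemma lncount_nrough n : (n <= N)%N ->
  lncount (fun a => (a <= n)%N) =
  \sum_(1 <= j < N.+1 | pi.-nat j) lnjump j * (nrough t (n %/ j))%:R.
Proof.
move=> nN; rewrite (lncount_sum nN).
transitivity (\sum_(1 <= j < N.+1 | pi.-nat j)
    \sum_(1 <= k < n.+1) lnjump j * (k`_pi == j)%N%:R : R); last first.
  rewrite big_nat_cond [RHS]big_nat_cond; apply: eq_bigr => j /andP[/andP[j0 _] sj].
  by rewrite nrough_sum // natr_sum mulr_sumr.
rewrite exchange_big [LHS]big_nat [RHS]big_nat; apply: eq_bigr => k /andP[k0 kn].
set kp := (k`_pi)%N; have kN : (1 <= kp < N.+1)%N.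
  rewrite part_gt0 ltnS (leq_trans _ nN) // (@leq_trans k) //.
  by rewrite dvdn_leq // dvdn_part.
rewrite big_mkcond (bigD1_seq kp) ?iota_uniq ?mem_index_iota //= part_pnat eqxx mulr1.
rewrite big1 ?addr0 // => j jk.
by rewrite eq_sym (negbTE jk) mulr0 if_same.
Qed.
End LogCount.

(** * Comparing two ranges, and primitive with [t]-primitive sets *)

Section Compare.
Variables (R : realType) (N t : nat).

(** The sieve supplies the factors [1 + w p] for each smooth [j]; summing [w j] over the smooth [j]
    supplies the factors [1 / (1 - w p)]. *)
Lemma lncount_density (w : nat -> R) (c : R) (n : nat) :
  (forall a, 0 <= w a) -> w 1 = 1 -> (forall a b, w (a * b)%N = w a * w b) ->
  (forall p, prime p -> w p < 1) -> 0 <= c ->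
  (forall j, (0 < j)%N -> `|(N %/ j)%:R / N%:R - (n %/ j)%:R / n%:R| <= c * w j) ->
  (n <= N)%N ->
  `|lncount R N t (fun a => (a <= N)%N) / N%:R -
    lncount R N t (fun a => (a <= n)%N) / n%:R| <=
  ln 2 * (c * \prod_(0 <= p < t.+1 | prime p) ((1 + w p) / (1 - w p))).
Proof.
move=> w0 w1 wM wlt1 c0 H nN; rewrite !lncount_nrough // !mulr_suml -sumrB.
apply: (le_trans (ler_norm_sum _ _ _)).
set W := \prod_(0 <= p < t.+1 | prime p) (1 + w p).
set V := \prod_(0 <= p < t.+1 | prime p) (1 - w p)^-1.
have W0 : 0 <= W by apply: prodr_ge0 => p _; rewrite addr_ge0.
have ln20 : 0 <= ln 2 :> R by rewrite ln_ge0 // ler1n.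
rewrite big_split -/W -/V /=.
apply: (@le_trans _ _ (\sum_(1 <= j < N.+1 | (le_pred t).-nat j) ln 2 * (c * W) * w j)).
  rewrite big_nat_cond [X in _ <= X]big_nat_cond.
  apply: ler_sum => j /andP[/andP[j0 _] _].
  rewrite -!mulrA -mulrBr normrM ger0_norm ?lnjump_ge0 // ler_pM ?lnjump_ge0 ?lnjump_le //.
  apply: (le_trans (nrough_density wM H t j0)) => //.
  by rewrite -mulrA (mulrC (w j)).
rewrite -mulr_sumr !mulrA ler_wpM2l ?mulr_ge0 //.
exact: (sum_smooth_le w0 w1 wM).
Qed.

Lemma ln_natr_le a b : (0 < a)%N -> (a <= b)%N -> ln a%:R <= ln b%:R :> R.
Proof. by move=> a0 ab; rewrite ler_ln ?posrE ?ltr0n ?ler_nat // (leq_trans a0). Qed.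

Definition multiple_ord m : rel 'I_m := fun a b => (a != b) && (a %| b)%N.

Lemma Q_nind n : (n <= N)%N ->
  Q n = nind (@multiple_ord N.+1) [set a : 'I_N.+1 | (0 < a)%N && (a <= n)%N]%SET.
Proof.
move=> nN; have inj : injective (widen_ord (nN : n.+1 <= N.+1)%N).
  by move=> x y /(congr1 val) /= xy; exact: val_inj.
have -> : [set a : 'I_N.+1 | (0 < a)%N && (a <= n)%N]%SET =
    (widen_ord (nN : n.+1 <= N.+1)%N @: [set a : 'I_n.+1 | (0 < a)%N])%SET.
  apply/finset.setP => a; rewrite inE; apply/andP/imsetP => [[a0 an]|[b + ->]].
    by exists (inord a); rewrite ?inE ?inordK //; apply: val_inj; rewrite /= inordK.
  by rewrite inE => b0; split => //; exact: (ltn_ord b).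
rewrite (@nind_imset _ _ _ (@multiple_ord n.+1)); [|by move=> x y _ _; exact: inj|by []].
congr #|pred_of_set _|; apply/finset.setP => A; rewrite !inE /primitive.
congr (_ && _).
  apply/forall_inP/fintype.subsetP => H a aA; have := H a aA; by rewrite inE.
by apply/forall_inP/forall_inP => H a aA; apply/forall_inP => b bA;
  have /forall_inP/(_ b bA) := H a aA; rewrite /multiple_ord negb_and implybE negbK.
Qed.

Lemma lnQ_le_lncount n : (n <= N)%N ->
  ln (Q n)%:R <= lncount R N t (fun a => (a <= n)%N).
Proof.
move=> nN; rewrite (Q_nind nN) ln_natr_le ?nind_gt0 //.
apply: nind_rel => x y _ _ /and3P[xy dxy _]; rewrite /multiple_ord dxy andbT.
by apply: contra xy => /eqP ->.
Qed.

(** The integers up to [n / t] cost a factor of at most [2 ^ (n %/ t)]. Above them a quotient is at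
    most [t], hence smooth, and both notions of primitivity agree. *)
Lemma lncount_le_lnQ n : (0 < t)%N -> (n <= N)%N ->
  lncount R N t (fun a => (a <= n)%N) <= ln (Q n)%:R + n%:R / t%:R * ln 2.
Proof.
move=> t0 nN.
pose X := [set a : 'I_N.+1 | (n %/ t < a <= n)%N]%SET.
pose Y := [set a : 'I_N.+1 | (0 < a <= n %/ t)%N]%SET.
have Yle : (#|Y| <= n %/ t)%N.
  rewrite -[X in (_ <= X)%N](card_ord (n %/ t)).
  pose f (i : 'I_(n %/ t)) : 'I_N.+1 := inord i.+1.
  apply: leq_trans (leq_imset_card f _).
  apply/subset_leq_card/fintype.subsetP => a; rewrite inE => /andP[a0 an].
  have an' : (a.-1 < n %/ t)%N by rewrite prednK.
  apply/imsetP; exists (Ordinal an') => //.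
  by apply: val_inj; rewrite /f /= prednK // inord_val.
have le1 : (nsmooth_primitive N t (fun a => (a <= n)%N) <= 2 ^ (n %/ t) * Q n)%N.
  apply: (@leq_trans (nind (@smooth_dvd_ord N t) (X :|: Y))).
    apply/nind_sub/fintype.subsetP => a; rewrite !inE => /andP[a0 an].
    by rewrite a0 an andbT /=; case: ltnP.
  apply: (leq_trans (nindU_le _ _ _)); apply: leq_mul; first by rewrite leq_exp2l.
  rewrite (Q_nind nN); apply: (@leq_trans (nind (@multiple_ord N.+1) X)); last first.
    apply/nind_sub/fintype.subsetP => a; rewrite !inE => /andP[an ->].
    by rewrite (leq_ltn_trans _ an).
  apply: nind_rel => x y; rewrite !inE => /andP[nx xn] /andP[ny yn] /andP[xy dxy].
  have x0 : (0 < x)%N by exact: leq_ltn_trans nx.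
  apply/and3P; split => //.
  have yx0 : (0 < y %/ x)%N by rewrite divn_gt0 // dvdn_leq // (leq_ltn_trans _ ny).
  apply/(pnatP _ yx0) => p pp /(dvdn_leq yx0) pyx; rewrite inE (leq_trans pyx) //.
  rewrite -ltnS ltn_divLR // (leq_ltn_trans yn) // mulSn.
  by move: nx; rewrite ltn_divLR // => nx; rewrite mulnC (leq_trans nx) // leq_addl.
apply: (le_trans (ln_natr_le (nind_gt0 _ _) le1)).
have Q0 : (0 < Q n)%N by rewrite (Q_nind nN) nind_gt0.
rewrite natrM lnM ?posrE ?ltr0n ?expn_gt0 // addrC lerD2l.
rewrite natrX lnXn // -[X in X <= _]mulr_natl ler_wpM2r ?ln_ge0 ?ler1n //.
rewrite ler_pdivlMr ?ltr0n // -natrM ler_nat leq_trunc_div //.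
Qed.

End Compare.

(** * Sums over primes *)

Section Chebyshev.
Local Open Scope nat_scope.

Lemma prod_primes_dvdn (s : seq nat) (M : nat) : uniq s ->
  {in s, forall p, prime p && (p %| M)} -> \prod_(p <- s) p %| M.
Proof.
elim: s => [|p s IH] /=; first by rewrite big_nil dvd1n.
move=> /andP[ps us] H; rewrite big_cons.
have /andP[pp pM] := H p (mem_head _ _).
rewrite Gauss_dvd ?pM ?IH //; first by move=> q qs; apply: H; rewrite inE qs orbT.
rewrite big_seq; apply: (big_ind (coprime p)) => [|a b|q qs]; first exact: coprimen1.
  by move=> pa pb; rewrite coprimeMr pa.
have /andP[qp _] : prime q && (q %| M) by apply: H; rewrite inE qs orbT.
by rewrite prime_coprime // dvdn_prime2 //; apply: contra ps => /eqP ->.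
Qed.

Lemma bin_le_exp2 n m : 'C(n, m) <= 2 ^ n.
Proof.
have [mn|/bin_small -> //] := leqP m n.
rewrite -[2]/(1 + 1) expnDn (bigD1 (Ordinal (mn : m < n.+1))) //=.
by rewrite !exp1n !muln1 leq_addr.
Qed.

(** Such a prime divides the factorial of [2m] but not that of [m]. *)
Lemma prime_dvd_central_bin m p : prime p -> m < p <= m.*2 -> p %| 'C(m.*2, m).
Proof.
move=> pp /andP[mp pm].
have p_fact k : k < p -> ~~ (p %| k`!).
  elim: k => [|k IH] kp; first by rewrite dvdn1 neq_ltn prime_gt1 ?orbT.
  by rewrite factS Euclid_dvdM // negb_or IH ?(ltnW kp) // andbT gtnNdvd.
have : p %| 'C(m.*2, m) * (m`! * (m.*2 - m)`!).
  by rewrite bin_fact ?dvdn_fact ?(prime_gt0 pp) // -addnn leq_addr.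
by rewrite -addnn addnK !Euclid_dvdM // (negbTE (p_fact _ mp)) !orbF.
Qed.

(** The product of the primes in the dyadic block divides a central binomial coefficient, which is
    at most [2 ^ (2 ^ i.+1)], while each of these primes exceeds [2 ^ i]. Compare exponents of 2. *)
Lemma primes_dyadic_le i :
  i * (\sum_((2 ^ i).+1 <= p < (2 ^ i.+1).+1 | prime p) 1) <= 2 ^ i.+1.
Proof.
set s := [seq p <- index_iota (2 ^ i).+1 (2 ^ i.+1).+1 | prime p].
have -> : \sum_((2 ^ i).+1 <= p < (2 ^ i.+1).+1 | prime p) 1 = size s.
  by rewrite -big_filter sum1_size.
have memS p : p \in s -> prime p && (2 ^ i < p <= (2 ^ i).*2).
  by rewrite mem_filter mem_index_iota ltnS expnS mul2n.
have pow : (2 ^ i) ^ size s <= \prod_(p <- s) p.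
  have : {in s, forall p, 2 ^ i <= p} by move=> p /memS /and3P[_ /ltnW].
  elim: (s) => [|p r IH] H; first by rewrite big_nil.
  rewrite big_cons expnS leq_mul ?H ?mem_head // IH // => q qr.
  by apply: H; rewrite inE qr orbT.
have dvd : \prod_(p <- s) p %| 'C((2 ^ i).*2, 2 ^ i).
  apply: prod_primes_dvdn; first by rewrite filter_uniq // iota_uniq.
  by move=> p /memS /andP[pp pi]; rewrite pp prime_dvd_central_bin.
have := leq_trans pow (dvdn_leq _ dvd); rewrite bin_gt0 -addnn leq_addr => /(_ isT).
move=> /leq_trans /(_ (bin_le_exp2 _ _)).
by rewrite -expnM leq_exp2l // addnn -mul2n -expnS.
Qed.

End Chebyshev.

(** * Reciprocal prime sums and the explicit comparison bound *)

Section PrimeSums.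
Variable R : realType.

(** The prime 2 gives [2^-1]. The block above [2 ^ i] has at most [2 ^ i.+1 / i] primes, each with
    reciprocal at most [2 ^- i], so it gives at most [2 / i]. *)
Lemma sum_inv_primes_le K : (0 < K)%N ->
  \sum_(0 <= p < (2 ^ K).+1 | prime p) (p%:R^-1 : R) <=
    2^-1 + 2 * \sum_(1 <= i < K) i%:R^-1.
Proof.
elim: K => // -[_ _|K IH _].
  rewrite (@big_geq _ _ _ 1 1) // mulr0 addr0 big_mkcond expn1.
  by rewrite !big_nat_recl //= big_nil /= !add0r addr0.
rewrite (@big_cat_nat _ _ _ (2 ^ K.+1).+1) //=; last by rewrite ltnS leq_exp2l.
rewrite [in leRHS]big_nat_recr //= mulrDr addrA; apply: lerD; first exact: IH.
apply: (@le_trans _ _ (\sum_((2 ^ K.+1).+1 <= p < (2 ^ K.+2).+1 | prime p) (2 ^ K.+1)%:R^-1)).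
  rewrite big_nat_cond [leRHS]big_nat_cond; apply: ler_sum => p /andP[/andP[p1 _] _].
  by rewrite lef_pV2 ?posrE ?ltr0n ?expn_gt0 // ?ler_nat ?(ltnW p1) // (leq_trans _ p1).
have := primes_dyadic_le K.+1.
set m := (\sum_(_ <= p < _ | prime p) 1)%N => Km.
have -> : \sum_((2 ^ K.+1).+1 <= p < (2 ^ K.+2).+1 | prime p) (2 ^ K.+1)%:R^-1 =
    m%:R * (2 ^ K.+1)%:R^-1 :> R.
  by rewrite /m natr_sum mulr_suml; apply: eq_bigr => p _; rewrite mul1r.
rewrite ler_pdivrMr ?ltr0n ?expn_gt0 // -mulrA mulrCA ler_pdivlMl ?ltr0n //.
by rewrite -!natrM ler_nat -expnS.
Qed.

Lemma harmonic_le K : (0 < K)%N -> \sum_(1 <= i < K) i%:R^-1 <= 1 + ln K%:R :> R.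
Proof.
move=> K0; apply: (@le_trans _ _ (\sum_(1 <= i < K.+1) i%:R^-1)).
  by rewrite big_nat_recr //= lerDl invr_ge0.
elim: K K0 => // -[_ _|K IH _]; first by rewrite big_nat1 ln1 invr1 addr0.
rewrite big_nat_recr //=; apply: (le_trans (lerD (IH isT) (lexx _))).
rewrite -addrA lerD2l -lerBrDl.
have K1 : K.+1%:R != 0 :> R by rewrite pnatr_eq0.
have K2 : K.+2%:R != 0 :> R by rewrite pnatr_eq0.
have e : ln K.+2%:R - ln K.+1%:R = - ln (1 - K.+2%:R^-1) :> R.
  rewrite -[LHS]opprB -ln_div ?posrE ?ltr0n //; congr (- ln _).
  by apply: (mulIf K2); rewrite mulfVK // mulrBl mul1r mulVf // -(@natrB _ _ 1) // subn1.
rewrite e lerNr; apply: le_ln1Dx.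
by rewrite ltrN2 invf_lt1 ?ltr0n // ltr1n.
Qed.

Lemma prod_euler_le (t : nat) (w : nat -> R) :
  (forall p, prime p -> 0 <= w p <= 3 / 4) ->
  \prod_(0 <= p < t | prime p) ((1 + w p) / (1 - w p)) <=
    expR (5 * \sum_(0 <= p < t | prime p) w p).
Proof.
move=> w34; rewrite mulr_sumr expR_sum.
apply: ler_prod => p /w34 /andP[w0 w3]; apply/andP; split.
  by rewrite divr_ge0 //; lra.
(* The numerator is at most [exp (w p)]; the denominator accounts for [exp (4 * w p)], because
   [1 - w p >= 1/4]. *)
rewrite (_ : 5 * w p = w p + 4 * w p); last ring.
rewrite expRD ler_pM ?expR_ge1Dx //; [lra|by rewrite invr_ge0; lra|].
rewrite -[4 * _]opprK expRN lef_pV2 ?posrE ?expR_gt0; [|lra|by []].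
(* [1 / (1 - x) = 1 + x / (1 - x) <= exp (x / (1 - x))] *)
have x1 : 0 < 1 - w p by lra.
have -> : 1 - w p = (1 + w p / (1 - w p))^-1.
  by rewrite -[X in (X + _)^-1](divff (lt0r_neq0 x1)) -mulrDl subrK mul1r invrK.
rewrite expRN lef_pV2 ?posrE ?expR_gt0 //; last by rewrite ltr_wpDr // divr_ge0 // ltW.
apply: (le_trans (expR_ge1Dx _)); rewrite ler_expR ler_pdivrMr //.
have -> : 4 * w p * (1 - w p) = w p * (4 - 4 * w p) by ring.
by rewrite ler_peMr //; lra.
Qed.

(** Both ratios lie between [max (0, 1/j - 1/n)] and [1/j], so they differ by at most
    [min (1/n, 1/j)], which is bounded by the weighted geometric mean with exponents [eta] and
    [1 - eta]. *)
Lemma floor_ratio_le (eta : R) (n N j : nat) : 0 <= eta <= 1 ->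
  (0 < n <= N)%N -> (0 < j)%N ->
  `|(N %/ j)%:R / N%:R - (n %/ j)%:R / n%:R| <= n%:R `^ (- eta) * j%:R `^ (eta - 1).
Proof.
move=> /andP[eta0 eta1] /andP[n0 nN] j0.
have N0 : (0 < N)%N by exact: leq_trans nN.
have jR : 0 < j%:R :> R by rewrite ltr0n.
have nR : 0 < n%:R :> R by rewrite ltr0n.
have NR : 0 < N%:R :> R by rewrite ltr0n.
have ub m : (0 < m)%N -> (m %/ j)%:R / m%:R <= j%:R^-1 :> R.
  move=> m0; rewrite ler_pdivrMr ?ltr0n // ler_pdivlMl // -natrM ler_nat mulnC.
  exact: leq_trunc_div.
have lb m : (0 < m)%N -> j%:R^-1 - m%:R^-1 <= (m %/ j)%:R / m%:R :> R.
  move=> m0; have mR : 0 < m%:R :> R by rewrite ltr0n.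
  rewrite lerBlDr -[X in _ + X]mul1r -mulrDl natr1 ler_pdivlMr // ler_pdivrMl //.
  by rewrite -natrM ler_nat mulnC ltnW // ltn_ceil.
have nNR : N%:R^-1 <= n%:R^-1 :> R by rewrite lef_pV2 ?posrE // ler_nat.
have powE m : (0 < m)%N -> m%:R^-1 = m%:R `^ (- eta) * m%:R `^ (eta - 1) :> R.
  move=> m0; rewrite -powRD ?pnatr_eq0 -?lt0n ?m0 ?implybT // addrA addNr add0r.
  by rewrite powR_inv1 ?ler0n.
have A0 m : 0 <= (m %/ j)%:R / m%:R :> R by rewrite divr_ge0.
have := ub n n0; have := ub N N0; have := lb n n0; have := lb N N0.
have := A0 n; have := A0 N.
move: (_ / N%:R) (_ / n%:R) => a b a0 b0 la lb' ua ub'.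
have [jn|nj] := leqP j n.
  apply: (@le_trans _ _ (n%:R^-1)); first by rewrite ler_norml; apply/andP; split; lra.
  rewrite powE // ler_wpM2l ?powR_ge0 // -opprB !powRN lef_pV2 ?posrE ?powR_gt0 //.
  by apply: ge0_ler_powR; rewrite ?nnegrE ?ler0n ?ler_nat //; lra.
apply: (@le_trans _ _ (j%:R^-1)); first by rewrite ler_norml; apply/andP; split; lra.
rewrite powE // ler_wpM2r ?powR_ge0 // !powRN lef_pV2 ?posrE ?powR_gt0 //.
by apply: ge0_ler_powR; rewrite ?nnegrE ?ler0n ?ler_nat // ltnW.
Qed.

(** Here [t = 2 ^ K]. The first exponential is [1 / t], the cost of passing to [t]-primitive sets.
    The second is the Euler product, bounded with [p^eta <= t^eta] and the reciprocal prime sum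
    [1/2 + 2 (1 + ln K)]. *)
Lemma lnQ_compare (eta : R) (n N K : nat) : 0 <= eta <= 2^-1 ->
  (0 < n <= N)%N -> (0 < K)%N ->
  `|ln (Q N)%:R / N%:R - ln (Q n)%:R / n%:R| <=
    ln 2 * (expR (- (K%:R * ln 2)) +
      expR (5 * (expR (eta * (K%:R * ln 2)) * (5 / 2 + 2 * ln K%:R)) - eta * ln n%:R)).
Proof.
move=> /andP[eta0 eta2] nN K0; have /andP[n0 nN'] := nN.
have N0 : (0 < N)%N by exact: leq_trans nN'.
have nR : 0 < n%:R :> R by rewrite ltr0n.
have NR : 0 < N%:R :> R by rewrite ltr0n.
pose t := (2 ^ K)%N; have t0 : (0 < t)%N by rewrite expn_gt0.
have tE : t%:R = expR (K%:R * ln 2) :> R.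
  by rewrite mulrC mulr_natr -lnXn // lnK ?natrX // posrE exprn_gt0.
pose w a : R := a%:R `^ (eta - 1).
have wp p : prime p -> w p <= p%:R^-1 * expR (eta * ln p%:R).
  move=> /prime_gt0 p0; rewrite /w /powR pnatr_eq0 eqn0Ngt p0 /= mulrBl mul1r.
  by rewrite expRD expRN lnK ?posrE ?ltr0n // mulrC.
(* As [eta <= 1/2], the square of [w p] is at most [1/p <= 1/2 < 9/16]. *)
have wle p : prime p -> 0 <= w p <= 3 / 4.
  move=> pp; rewrite powR_ge0 /=; have p0 := prime_gt0 pp.
  rewrite -(@ler_pXn2r _ 2) ?nnegrE ?powR_ge0 //.
  apply: (@le_trans _ _ (2^-1)); last by lra.
  rewrite /w /powR pnatr_eq0 eqn0Ngt p0 /= -expRM_natl.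
  apply: (@le_trans _ _ (expR (- ln p%:R))).
    rewrite ler_expR mulrA -[leRHS]mulN1r ler_wpM2r ?ln_ge0 ?ler1n //; lra.
  rewrite expRN lnK ?posrE ?ltr0n // lef_pV2 ?posrE ?ltr0n // ler_nat.
  exact: prime_gt1.
have wlt1 p : prime p -> w p < 1 by move=> /wle /andP[_]; lra.
have eta1 : 0 <= eta <= 1 by apply/andP; split; lra.
have w1 : w 1%N = 1 by rewrite /w powR1.
have wM a b : w (a * b)%N = w a * w b by rewrite /w natrM powRM.
have D := @lncount_density R N t w (n%:R `^ (- eta)) n (fun=> powR_ge0 _ _)
  w1 wM wlt1 (powR_ge0 _ _) (fun j => @floor_ratio_le eta n N j eta1 nN) nN'.
have {}D : `|lncount R N t (fun a => (a <= N)%N) / N%:R -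
    lncount R N t (fun a => (a <= n)%N) / n%:R| <=
  ln 2 * expR (5 * (expR (eta * (K%:R * ln 2)) * (5 / 2 + 2 * ln K%:R)) - eta * ln n%:R).
  apply: (le_trans D); rewrite ler_wpM2l ?ln_ge0 ?ler1n // addrC expRD.
  rewrite /powR (gt_eqF nR) mulNr ler_wpM2l ?expR_ge0 //.
  apply: (le_trans (prod_euler_le _ wle)); rewrite ler_expR ler_wpM2l //.
  apply: (@le_trans _ _ (\sum_(0 <= p < t.+1 | prime p)
      expR (eta * (K%:R * ln 2)) * p%:R^-1)).
    rewrite big_nat_cond [leRHS]big_nat_cond; apply: ler_sum => p /andP[/andP[_ pt] pp].
    apply: (le_trans (wp p pp)); rewrite mulrC ler_wpM2r ?invr_ge0 //.
    rewrite ler_expR ler_wpM2l // -[leRHS]expRK -tE.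
    by rewrite ln_natr_le // prime_gt0.
  rewrite -mulr_sumr ler_wpM2l ?expR_ge0 //.
  apply: (le_trans (sum_inv_primes_le K0)).
  by have := harmonic_le K0; lra.
(* Both corrections lie in the same interval [[0, ln 2 / t]], so their difference costs [ln 2 / t]
   only once. *)
have u n1 : (0 < n1 <= N)%N -> 0 <= lncount R N t (fun a => (a <= n1)%N) / n1%:R -
    ln (Q n1)%:R / n1%:R <= ln 2 * expR (- (K%:R * ln 2)).
  move=> /andP[n10 n1N]; have n1R : 0 < n1%:R :> R by rewrite ltr0n.
  rewrite -mulrBl divr_ge0 ?subr_ge0 ?lnQ_le_lncount //=.
  rewrite ler_pdivrMr // lerBlDl; apply: (le_trans (lncount_le_lnQ R t0 n1N)).
  by rewrite expRN -tE lerD2l le_eqVlt; apply/orP; left; apply/eqP; ring.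
have NN : (0 < N <= N)%N by rewrite N0 leqnn.
have /andP[n1 n2] := u n nN; have /andP[N1 N2] := u N NN.
move: D; rewrite ler_norml => /andP[D1 D2].
by rewrite ler_norml mulrDr; apply/andP; split; lra.
Qed.

End PrimeSums.

(** * Rate of convergence *)

Section Rate.
Variable R : realType.
Implicit Types n N : nat.

Definition rate n : R := ln (Q n)%:R / n%:R.

(** The threshold is generous; what it must ensure is [50 + 40 * l <= exp (l / 4)] for
    [l = ln (ln n)]. Since [ln] vanishes off the positive reals, small [n] are excluded too. *)
Definition large n := 4000 <= ln (ln n%:R) :> R.

Lemma ln2_ge : 2^-1 <= ln 2 :> R.
Proof.
rewrite -ler_expR lnK ?posrE // -[leLHS]opprK opprK -lef_pV2 ?posrE ?expR_gt0 // -expRN.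
by apply: le_trans (expR_ge1Dx _); lra.
Qed.

Lemma ln2_le : ln 2 <= 1 :> R.
Proof. by have := @le_ln1Dx R 1; rewrite (_ : 1 + 1 = 2) ?natrD //; apply; lra. Qed.

Lemma large_gt1 n : large n -> 1 < ln n%:R :> R.
Proof.
rewrite /large; move=> H; rewrite ltNge; apply/negP => /ln_le0; lra.
Qed.

Lemma large_gt0 n : large n -> (0 < n)%N.
Proof. by move=> /large_gt1; case: n => //; rewrite ln0 //; lra. Qed.

Lemma large_le n N : large n -> (n <= N)%N -> large N.
Proof.
move=> nl nN; have n1 := large_gt1 nl; have n0 := large_gt0 nl.
apply: (le_trans nl); rewrite ler_ln ?posrE ?ln_natr_le //; first by lra.
by apply: (lt_le_trans _ (ln_natr_le R n0 nN)); lra.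
Qed.

Lemma exists_large : exists n, large n.
Proof.
set y : R := expR (expR 4000); exists (Num.truncn y).+1.
rewrite /large -[leLHS]expRK -(expRK (expR 4000)).
have ym : y <= (Num.truncn y).+1%:R by rewrite ltW // truncnS_gt.
have y0 : 0 < y by exact: expR_gt0.
have l : ln y <= ln (Num.truncn y).+1%:R by rewrite ler_ln ?posrE ?ltr0n.
have ly0 : 0 < ln y by rewrite expRK expR_gt0.
by rewrite ler_ln ?posrE // (lt_le_trans ly0).
Qed.

Lemma large_sqrt n : large n ->
  let s := Num.sqrt (6^-1 * ln n%:R * ln (ln n%:R)) : R in
  s ^+ 2 = 6^-1 * ln n%:R * ln (ln n%:R) /\ expR (ln (ln n%:R) / 2) <= s.
Proof.
move=> nl s; have n1 := large_gt1 nl; move: nl; rewrite /large => nl.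
have s2 : s ^+ 2 = 6^-1 * ln n%:R * ln (ln n%:R) by rewrite sqr_sqrtr // !mulr_ge0 //; lra.
split => //; rewrite -(@ler_pXn2r _ 2) ?nnegrE ?sqrtr_ge0 ?expR_ge0 // s2.
rewrite -expRM_natl (_ : 2%:R * (ln (ln n%:R) / 2) = ln (ln n%:R)); last by field.
by rewrite lnK ?posrE; nra.
Qed.

Lemma rate_compare n N : large n -> (n <= N)%N ->
  `|rate N - rate n| <= 2 * error_term 6^-1 n.
Proof.
move=> nl nN; have n1 := large_gt1 nl; have [] := large_sqrt nl.
have n0 := large_gt0 nl.
rewrite /error_term; set s := Num.sqrt _; move: nl; rewrite /large.
set x := ln n%:R in n1 *; set l := ln x => l4 s2 sl.
have xE : x = expR l by rewrite lnK // posrE; lra.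
have e2 : 1 + l / 2 <= expR (l / 2) by exact: expR_ge1Dx.
have e2x : expR (l / 2) ^+ 2 = x.
  by rewrite -expRM_natl xE; congr expR; field.
have ln2a := ln2_ge; have ln2b := ln2_le.
(* Rounding up makes [t = 2 ^ K] satisfy [s <= ln t <= s + 1]. *)
pose K := (Num.truncn (s / ln 2)).+1.
have s0 : 2001 <= s by lra.
have sK : s <= K%:R * ln 2.
  by rewrite -ler_pdivrMr ?(lt_le_trans _ ln2a) // ltW // truncnS_gt.
have Ks : K%:R * ln 2 <= s + 1.
  have : (Num.truncn (s / ln 2))%:R <= s / ln 2 by rewrite truncn_le divr_ge0 //; lra.
  rewrite ler_pdivlMr; last by lra.
  by rewrite /K -(natr1 (Num.truncn _)) mulrDl mul1r; lra.
have K1 : 1 <= K%:R :> R by rewrite ler1n.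
have K3 : K%:R <= 3 * s by nra.
(* [K <= 3 s <= x], because [9 s^2 = (3/2) l x] and [(3/2) l <= x]. *)
have lnK : ln K%:R <= l.
  rewrite ler_ln ?posrE ?ltr0n //; last by lra.
  apply: (le_trans K3); rewrite -(@ler_pXn2r _ 2) ?nnegrE //; [|lra|lra].
  rewrite exprMn s2 (_ : _ * _ = x * (3 / 2 * l)); last by field.
  have lx : 3 / 2 * l <= x by rewrite -e2x; nra.
  by rewrite expr2 ler_wpM2l //; lra.
have lnK0 : 0 <= ln K%:R :> R by rewrite ln_ge0.
(* Chosen so that [t^eta = exp (l / 4)], the fourth root of [ln n]. *)
pose eta := (l / 4) / (K%:R * ln 2).
have KL : 0 < K%:R * ln 2 :> R by lra.
have eta01 : 0 <= eta <= 2^-1.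
  apply/andP; split; first by rewrite divr_ge0 //; lra.
  by rewrite ler_pdivrMr //; lra.
have nNn : (0 < n <= N)%N by rewrite n0.
apply: (le_trans (lnQ_compare eta01 nNn (ltn0Sn _ : (0 < K)%N))).
rewrite -/x (_ : eta * (K%:R * ln 2) = l / 4); last by rewrite /eta divfK // gt_eqF.
(* The constant 1/6 enters here: [l x = 6 s^2] makes [eta * x] equal to [(3/2) s^2 / ln t]. The
   surplus [s / 4] over [s] pays for the prime sum. *)
have etax : 5 / 4 * s <= eta * x.
  rewrite /eta [leRHS]mulrAC ler_pdivlMr // (_ : l / 4 * x = 3 / 2 * s ^+ 2);
    last by rewrite s2; field.
  by nra.
have e8 : 1 + l / 8 <= expR (l / 8) by exact: expR_ge1Dx.
have e8x : expR (l / 8) ^+ 2 = expR (l / 4).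
  by rewrite -expRM_natl; congr expR; field.
have e4x : expR (l / 4) ^+ 2 = expR (l / 2).
  by rewrite -expRM_natl; congr expR; field.
have e4 : 50 + 40 * l <= expR (l / 4) by rewrite -e8x; nra.
(* [5 (5/2 + 2 l)] is [(50 + 40 l) / 4], and [exp (l / 4)] squared is [exp (l / 2) <= s]. *)
have main : 5 * (expR (l / 4) * (5 / 2 + 2 * ln K%:R)) <= s / 4.
  apply: (@le_trans _ _ (expR (l / 4) * (50 + 40 * l) / 4)).
    have := expR_gt0 (l / 4); move: (expR (l / 4)) => E E0; nra.
  rewrite ler_pM2r ?invr_gt0 // (le_trans _ sl) // -e4x expr2 ler_wpM2l ?expR_ge0 //.
have es : expR (- (K%:R * ln 2)) <= expR (- s) by rewrite ler_expR; lra.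
set F := expR (_ - _); have Fs : F <= expR (- s) by rewrite ler_expR; lra.
apply: (@le_trans _ _ (1 * (expR (- (K%:R * ln 2)) + F))); last by lra.
by rewrite ler_wpM2r // addr_ge0 // expR_ge0.
Qed.

Lemma error_term_le c n : c <= 6^-1 -> large n ->
  error_term 6^-1 n <= error_term c n :> R.
Proof.
move=> c6 nl; have n1 := large_gt1 nl; move: nl; rewrite /large => nl.
by rewrite ler_expR lerN2 ler_wsqrtr // !ler_wpM2r //; lra.
Qed.

Lemma error_term_small n : large n -> error_term 6^-1 n <= 32^-1 :> R.
Proof.
move=> nl; have [_] := large_sqrt nl; rewrite /error_term; set s := Num.sqrt _.
move=> /(le_trans (expR_ge1Dx _)) => sl; move: nl; rewrite /large => nl.
rewrite expRN lef_pV2 ?posrE ?expR_gt0 //.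
by apply: le_trans (expR_ge1Dx _); lra.
Qed.

Lemma Q_gt0 n : (0 < Q n)%N.
Proof. by rewrite (Q_nind (leqnn n)) nind_gt0. Qed.

(** Every subset of the upper half of [[1..n]] is primitive, and [ln 2 >= 1/2]. *)
Lemma rate_ge n : (0 < n)%N -> 4^-1 <= rate n.
Proof.
move=> n0; have Qn : (2 ^ (n - n./2) <= Q n)%N.
  pose m := n./2; pose X := [set a : 'I_n.+1 | (m < a)%N]%SET.
  have X_card : (n - m <= #|X|)%N.
    rewrite -[X in (X <= _)%N](card_ord (n - m)) -cardsT.
    apply: (@leq_card_in_inj _ _ (fun i : 'I_(n - m) => inord (m.+1 + i))).
      move=> i j _ _ /(congr1 val) /=; rewrite !inordK; first by move/addnI/val_inj.
        by have := ltn_ord j; rewrite /m; lia.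
      by have := ltn_ord i; rewrite /m; lia.
    move=> i _; rewrite inE inordK; last by have := ltn_ord i; rewrite /m; lia.
    by rewrite ltnS leq_addr.
  apply: (@leq_trans (2 ^ #|X|)); first by rewrite leq_exp2l.
  rewrite -card_powerset (Q_nind (leqnn n)).
  apply/subset_leq_card/fintype.subsetP => A; rewrite !inE => /fintype.subsetP AX.
  apply/andP; split.
    apply/fintype.subsetP => a /AX; rewrite !inE => ma.
    by rewrite (leq_ltn_trans _ ma) //= -ltnS ltn_ord.
  apply/independentP => a b /AX; rewrite inE => ma /AX; rewrite inE => mb.
  apply/negP => /andP[ab /dvdnP[q bqa]]; have := ltn_ord b; rewrite ltnS bqa.
  case: q bqa => [|[|q]] bqa; first by rewrite bqa in mb.
    by move: ab; rewrite -val_eqE /= bqa mul1n eqxx.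
  by rewrite leqNgt => /negP; apply; rewrite !mulSn; move: ma; rewrite /m; lia.
have nR : 0 < n%:R :> R by rewrite ltr0n.
rewrite /rate ler_pdivlMr //.
apply: le_trans (ln_natr_le R _ Qn); last by rewrite expn_gt0.
rewrite natrX lnXn // -[leRHS]mulr_natl.
have h : n%:R / 2 <= (n - n./2)%:R :> R.
  by rewrite ler_pdivrMr // -natrM ler_nat; lia.
have := ln2_ge; have := h; nra.
Qed.

(* The lower bounds [rate n - 2 error n] never exceed the upper bounds
   [rate m + 2 error m], so their supremum is within [2 error] of every [rate]. *)
Lemma rate_limit : exists L : R, 0 < L /\
  forall n, large n -> `|rate n - L| <= 2 * error_term 6^-1 n.
Proof.
have [n0 n0l] := exists_large.
pose lower := [set y : R | exists2 n, large n & y = rate n - 2 * error_term 6^-1 n]%classic.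
have ub n m : large n -> large m ->
    rate n - 2 * error_term 6^-1 n <= rate m + 2 * error_term 6^-1 m.
  move=> nl ml; have en : 0 < error_term 6^-1 n :> R by exact: expR_gt0.
  have em : 0 < error_term 6^-1 m :> R by exact: expR_gt0.
  have [nm|/ltnW mn] := leqP n m.
    by have := rate_compare nl nm; rewrite ler_norml => /andP[]; lra.
  by have := rate_compare ml mn; rewrite ler_norml => /andP[]; lra.
have supL : has_sup lower.
  split; first by exists (rate n0 - 2 * error_term 6^-1 n0), n0.
  by exists (rate n0 + 2 * error_term 6^-1 n0) => _ [n nl ->]; exact: ub.
have bounds m : large m -> rate m - 2 * error_term 6^-1 m <= sup lower <=
    rate m + 2 * error_term 6^-1 m.
  move=> ml; apply/andP; split; first by apply: sup_upper_bound => //; exists m.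
  by apply: ge_sup => [|_ [n nl ->]]; [case: supL|exact: ub].
exists (sup lower); split; last first.
  by move=> n /bounds /andP[a b]; rewrite ler_norml; apply/andP; split; lra.
(* Positivity of the limit: it is at least [1/4 - 2/32]. *)
have /andP[+ _] := bounds _ n0l; have := rate_ge (large_gt0 n0l).
have := error_term_small n0l; lra.
Qed.

End Rate.

(** * Computability of the limit *)

(** The integer part of the [e k]-th root of [B k], found as the least [a] with [B k < a.+1 ^ e k];
    [B k] itself shows that such an [a] exists. *)
Lemma recursive_root (B e : nat -> nat) : recursive1 B -> recursive1 e ->
  (forall k, 0 < e k)%N ->
  exists2 a : nat -> nat, recursive1 a &
    forall k, (a k ^ e k <= B k < (a k).+1 ^ e k)%N.
Proof.
move=> rB re e0.
have ex k : exists a, (B k < a.+1 ^ e k)%N.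
  exists (B k); rewrite -[X in (X < _)%N]expn1.
  apply: (@leq_trans ((B k).+1 ^ 1)); first by rewrite !expn1.
  by rewrite leq_pexp2l.
exists (fun k => ex_minn (ex k)) => [|k].
  apply: (@recursive_least 1
      (fun a x => (a.+1 ^ e (tnth x ord0) <= B (tnth x ord0))%N : nat)).
  - apply: recursive_leq; last exact: (recursive_behead rB).
    apply: recursive_exp; last exact: (recursive_behead re).
    by apply: recursive_succn; exact: recursive_head.
  - by move=> x; case: ex_minnP => a Ba _; rewrite leqNgt Ba.
  - move=> x a; case: ex_minnP => m _ minm am; rewrite leqNgt.
    by case: ltnP => // /minm; rewrite leqNgt am.
case: ex_minnP => -[|m] Bm minm; rewrite Bm andbT ?exp0n //.
by rewrite leqNgt; apply/negP => /minm; rewrite ltnn.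
Qed.

Section Main.
Variable R : realType.

Lemma expR_dist (u v d : R) : `|u - v| <= d -> d <= 2^-1 ->
  `|expR u - expR v| <= 2 * expR v * d.
Proof.
rewrite ler_norml => /andP[d1 d2] d12.
have e1 : 1 + (u - v) <= expR (u - v) by exact: expR_ge1Dx.
have e2 : 1 - (u - v) <= expR (- (u - v)) by exact: expR_ge1Dx.
have -> : expR u = expR v * expR (u - v) by rewrite -expRD; congr expR; ring.
have e3 : expR (u - v) * expR (- (u - v)) = 1 by rewrite -expRD subrr expR0.
have -> : expR v * expR (u - v) - expR v = expR v * (expR (u - v) - 1) by ring.
rewrite normrM ger0_norm ?expR_ge0 // -mulrA mulrCA ler_wpM2l ?expR_ge0 //.
have := expR_gt0 (u - v); move: d1 d2 e1 e2 e3.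
move: (u - v) => x; move: (expR x) (expR (- x)) => E F d1 d2 e1 e2 e3 E0.
rewrite ler_norml; apply/andP; split; first by lra.
(* From [E (1 - x) <= 1] and [x <= d <= 1/2], since [(1 + 2 d) (1 - d) >= 1]. *)
suff : E <= 1 + 2 * d by lra.
have [xd|] := leP E 1; first by lra.
nra.
Qed.

Lemma expR_rateX n : (0 < n)%N -> expR (rate R n) ^+ n = (Q n)%:R.
Proof.
move=> n0; rewrite -expRM_natl /rate mulrC divfK ?pnatr_eq0 -?lt0n //.
by rewrite lnK // posrE ltr0n Q_gt0.
Qed.

(** The approximations are the roots [Q (e k) ^ (1 / e k)] rounded down to multiples of
    [2 ^- (k + 2)]. Rounding and convergence each cost at most [2 ^- (k + 2)]. *)
Lemma computable_limit (L : R) :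
  (forall n, large R n -> `|rate R n - L| <= 2 * error_term 6^-1 n) ->
  computable_real (expR L).
Proof.
move=> HL; have [n0 n0l] := exists_large R.
pose M := (Num.truncn (4 * expR L)).+1.
(* [M] absorbs the factor [4 * exp L], [2] gives the spare bits and [n0] makes [e k] large. The
   square in the exponent compensates the square root in the error term, which becomes at most
   [2 ^- (k + c)]. All of them are fixed numbers, so [e] is recursive. *)
pose c := (M + 2 + n0)%N; pose e k := (2 ^ (2 * ((k + c) * (k + c))))%N.
have el k : large R (e k).
  apply: large_le n0l _; apply: leq_trans (ltnW (ltn_expl _ (ltnSn 1))).
  by rewrite /c; nia.
have e0 k : (0 < e k)%N by rewrite expn_gt0.
have rk : recursive (fun x : 1.-tuple nat => tnth x ord0) by exact: recursive_head.
have rc := recursive_const.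
have re : recursive1 e.
  have ra := recursive_add rk (rc 1%N c).
  apply: recursive_exp => //; apply: recursive_mul => //; exact: recursive_mul.
have rb : recursive1 (fun k => 2 ^ (k + 2))%N.
  by apply: recursive_exp => //; exact: recursive_add.
have rB : recursive1 (fun k => Q (e k) * (2 ^ (k + 2)) ^ e k)%N.
  apply: recursive_mul; first exact: (recursive_app1 recursive_Q re).
  exact: recursive_exp.
have [a ra aP] := recursive_root rB re e0.
exists (fun=> 0%N), a, (fun k => 2 ^ (k + 2))%N; split => //.
- by move=> k; apply/eqP; rewrite -lt0n expn_gt0.
move=> k; rewrite expr0 mul1r.
have err : error_term 6^-1 (e k) <= 2^-1 ^+ (k + c) :> R.
  have [s2 s0] := large_sqrt (el k); rewrite /error_term; move: s2 s0.
  set s := Num.sqrt _ => s2 s0.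
  have ek1 := large_gt1 (el k); have := el k; rewrite /large => ek4.
  have lne : ln (e k)%:R = 2 * (k + c)%:R ^+ 2 * ln 2 :> R.
    by rewrite /e natrX lnXn // -(mulr_natl (ln 2)) !natrM.
  have ks : (k + c)%:R <= s.
    rewrite -(@ler_pXn2r _ 2) ?nnegrE ?sqrtr_ge0 // s2.
    apply: (@le_trans _ _ (ln (e k)%:R)); last by nra.
    by rewrite lne; have := ln2_ge R; have := sqr_ge0 ((k + c)%:R : R); nra.
  rewrite exprVn -natrX -[X in _ <= X^-1](@lnK R) ?posrE ?ltr0n ?expn_gt0 // -expRN ler_expR.
  rewrite lerN2 natrX lnXn // -(mulr_natl (ln 2)) (le_trans _ ks) // ler_piMr //.
  exact: ln2_le.
set b : R := (2 ^ (k + 2))%:R.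
have b0 : 0 < b by rewrite ltr0n expn_gt0.
have beta : `|expR (rate R (e k)) - (a k)%:R / b| <= b^-1.
  have /andP[al au] := aP k.
  have al' : (a k)%:R <= expR (rate R (e k)) * b.
    rewrite -(@ler_pXn2r _ (e k)) ?nnegrE ?mulr_ge0 ?expR_ge0 ?(ltW b0) //.
    by rewrite exprMn expR_rateX // /b -!natrX -natrM ler_nat.
  have au' : expR (rate R (e k)) * b <= (a k)%:R + 1.
    rewrite -(@ler_pXn2r _ (e k)) ?nnegrE ?mulr_ge0 ?expR_ge0 ?addr_ge0 ?(ltW b0) //.
    by rewrite exprMn expR_rateX // /b natr1 -!natrX -natrM ler_nat ltnW.
  have bb : b^-1 * b = 1 by rewrite mulVf // gt_eqF.
  rewrite -(ler_pM2r b0) bb -[X in _ * X](gtr0_norm b0) -normrM mulrBl.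
  by rewrite divfK ?gt_eqF // ler_norml; apply/andP; split; lra.
have err2 : 2 * error_term 6^-1 (e k) <= 2^-1 :> R.
  by have := error_term_small (el k); lra.
have dist := expR_dist (HL _ (el k)) err2.
have small : 2 * expR L * (2 * error_term 6^-1 (e k)) <= b^-1.
  have LM : 4 * expR L <= 2 ^+ M.
    apply: (@le_trans _ _ M%:R); first by rewrite ltW // truncnS_gt.
    by rewrite -natrX ler_nat ltnW // ltn_expl.
  rewrite (_ : _ * _ = 4 * expR L * error_term 6^-1 (e k)); last by ring.
  apply: (@le_trans _ _ (2 ^+ M * 2^-1 ^+ (k + c))).
    by rewrite ler_pM ?expR_ge0 // mulr_ge0 ?expR_ge0.
  rewrite /b natrX -exprVn (_ : k + c = M + (k + 2) + n0)%N; last by rewrite /c; lia.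
  rewrite !exprD !mulrA -exprMn divff ?pnatr_eq0 // expr1n mul1r.
  by rewrite ler_piMr ?mulr_ge0 ?exprn_ge0 // exprn_ile1 //; lra.
apply: (@le_trans _ _ (b^-1 + b^-1)).
  rewrite -(subrKA (expR (rate R (e k)))); apply: (le_trans (ler_normD _ _)).
  by rewrite lerD // distrC (le_trans dist).
rewrite /b natrX exprD invfM; have : 0 < (2 ^+ k)^-1 :> R by rewrite invr_gt0 exprn_gt0.
by move: (2 ^- k) => y; lra.
Qed.

End Main.

(** * The asymptotic formula for [Q] *)

Local Open Scope classical_set_scope.

Theorem theorem2p1 (R : realType) :
  exists alpha : R,
    [/\ 0 < alpha,
        computable_real alpha &
        forall eps : R, 0 < eps ->
          (exists E : nat -> R,
             E =O_\oo (error_term (6^-1 - eps)) /\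
             \forall n \near \oo,
               (Q n)%:R = alpha `^ (n%:R * (1 + E n)))
          /\
          (fun n : nat => ln (Q n)%:R : R) =
            (fun n : nat => n%:R * ln alpha) +O_\oo
            (fun n : nat => n%:R * error_term (6^-1 - eps) n)].
Proof.
have [L [L0 HL]] := rate_limit R; have [n0 n0l] := exists_large R.
exists (expR L); split; [exact: expR_gt0|exact: computable_limit|].
move=> eps eps0.
have near_err n : (n0 <= n)%N -> `|rate R n - L| <= 2 * error_term (6^-1 - eps) n.
  move=> n0n; have nl := large_le n0l n0n; apply: (le_trans (HL n nl)).
  by rewrite ler_pM2l // error_term_le //; lra.
have err0 n : 0 < error_term (6^-1 - eps) n :> R by exact: expR_gt0.
split; last first.
  apply/eqaddOP/bigO_exP; exists 2; first by rewrite ltr0n.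
  near=> n; rewrite !fctE expRK.
  have n_gt0 : 0 < n%:R :> R by rewrite ltr0n; near: n; exact: nbhs_infty_ge.
  rewrite normrM (gtr0_norm n_gt0) (gtr0_norm (err0 n)) mulrCA.
  have -> : ln (Q n)%:R - n%:R * L = n%:R * (rate R n - L).
    by rewrite mulrBr /rate mulrCA divff ?gt_eqF // mulr1.
  rewrite normrM (gtr0_norm n_gt0) ler_pM2l //; apply: near_err.
  by near: n; exact: nbhs_infty_ge.
(* This [E] solves [ln (Q n) = n * L * (1 + E n)] exactly for [n > 0], and [L > 0] turns the bound
   on [rate R n - L] into one on [E n]. *)
exists (fun n => rate R n / L - 1); split.
  apply/eqO_exP; exists (2 / L); first by rewrite divr_gt0.
  near=> n; rewrite (gtr0_norm (err0 n)).
  have -> : rate R n / L - 1 = (rate R n - L) / L by rewrite mulrBl divff // gt_eqF.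
  rewrite normrM (gtr0_norm (_ : 0 < L^-1)) ?invr_gt0 // mulrAC ler_pM2r ?invr_gt0 //.
  by apply: near_err; near: n; exact: nbhs_infty_ge.
near=> n; have n_gt0 : (0 < n)%N by near: n; exact: nbhs_infty_ge.
rewrite addrCA subrr addr0 /powR gt_eqF ?expR_gt0 // expRK -mulrA divfK ?gt_eqF //.
by rewrite -expR_rateX // -expRM_natl.
Unshelve. all: by end_near.
Qed.
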